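(* Let $\xi$ be an invariant random measure on $G$ and let $\mathbb{Q}$ be a $\sigma$-finite measure on $(\Omega,\mathcal{F})$ with $\mathbb{Q}(\xi(G)=0)=0$. Then $\mathbb{Q}$ is mass-stationary for $\xi$ if and only if $\mathbb{Q}$ is invariant under all bounded $\xi$-preserving invariant weighted transport-kernels $T$, that is, if and only if for every such $T$ $$\mathbb{E}_{\mathbb{Q}}\left[\int f(\theta_t)\,T(0,dt)\right]=\mathbb{E}_{\mathbb{Q}}[f]$$ for all measurable $f:\Omega\to[0,\infty)$.
   Context: $G$ is a locally compact, second countable Hausdorff topological Abelian group with neutral element $0$, Borel $\sigma$-field $\mathcal{G}$ and fixed Haar measure $\lambda$. $\mathbf{M}$ is the set of locally finite measures on $G$ (finite on compact sets), with the $\sigma$-field generated by the maps $\mu\mapsto\mu(B)$, $B\in\mathcal{G}$. $(\Omega,\mathcal{F})$ is a measurable space equipped with a measurable flow $\theta_s:\Omega\to\Omega$, $s\in G$: $(\omega,s)\mapsto\theta_s\omega$ is measurable, $\theta_0$ is the identity, and $\theta_s\circ\theta_t=\theta_{s+t}$ for all $s,t\in G$. A random measure on $G$ is a measurable map $\xi:\Omega\to\mathbf{M}$, written $\xi(\omega,B):=\xi(\omega)(B)$; it is invariant if $\xi(\theta_s\omega,B-s)=\xi(\omega,B)$ for all $\omega\in\Omega$, $s\in G$, $B\in\mathcal{G}$. A weighted transport-kernel is a kernel $T$ from $\Omega\times G$ to $G$ such that $T(\omega,s,\cdot)$ is locally finite for all $(\omega,s)$. It is invariant if $T(\theta_t\omega,s-t,B-t)=T(\omega,s,B)$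 for all $s,t\in G$, $\omega\in\Omega$, $B\in\mathcal{G}$. It is $\xi$-preserving if $\int T(\omega,s,\cdot)\,\xi(\omega,ds)=\xi(\omega,\cdot)$ for all $\omega\in\Omega$. It is bounded if $\sup_{\omega,s}T(\omega,s,G)<\infty$. One writes $T(s,\cdot)$ for $\omega\mapsto T(\omega,s,\cdot)$, and $f(\theta_t)$ for $\omega\mapsto f(\theta_t\omega)$. $\mathbb{E}_{\mathbb{Q}}$ denotes integration with respect to $\mathbb{Q}$. For relatively compact $C\in\mathcal{G}$ put, suppressing $\omega$, $$T_C(t,B):=\xi(C+t)^{-1}\,\xi(B\cap(C+t)),\qquad t\in G,\ B\in\mathcal{G},$$ if $\xi(C+t)>0$, and let $T_C(t,\cdot)$ equal some fixed probability measure otherwise. If $0<\lambda(C)<\infty$, let $\lambda_C(B):=\lambda(B\cap C)/\lambda(C)$. $\partial C$ denotes the boundary of $C$. A $\sigma$-finite measure $\mathbb{Q}$ on $(\Omega,\mathcal{F})$ is called mass-stationary for $\xi$ if $\mathbb{Q}(\xi(G)=0)=0$ and $$\mathbb{E}_{\mathbb{Q}}\left[\iint \mathbf{1}_A(\theta_s,s+r)\,T_C(-r,ds)\,\lambda_C(dr)\right]=\mathbb{Q}\otimes\lambda_C(A),\qquad A\in\mathcal{F}\otimes\mathcal{G},$$ holds for all relatively compact sets $C\in\mathcal{G}$ with $\lambda(C)>0$ and $\lambda(\partial C)=0$. *)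

(* Defs.v *)
From HB Require Import structures.
From mathcomp Require Import all_boot all_order all_algebra.
From mathcomp Require Import all_classical all_reals all_analysis.
From mathcomp Require Import measurable_realfun.
Set Implicit Arguments.
Unset Strict Implicit.
Unset Printing Implicit Defensive.
Import Order.TTheory GRing.Theory Num.Theory.
Local Open Scope classical_set_scope.
Local Open Scope ring_scope.

(* [G] with its Borel sigma-algebra; an alias, because the library's
   hierarchy does not admit a join of topologicalZmodType and measurableType *)
Definition borel (G : topologicalZmodType) : Type := G.

HB.instance Definition _ (G : topologicalZmodType) :=
  TopologicalZmodule.on (borel G).
HB.instance Definition _ (G : topologicalZmodType) :=
  isPointed.Build (borel G) 0.
HB.instance Definition _ (G : topologicalZmodType) :=
  Measurable.copy (borel G) (g_sigma_algebraType (@open (borel G))).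

Lemma measurable_translate (G : topologicalZmodType) (t : borel G)
    (C : set (borel G)) :
  measurable C -> measurable [set c + t | c in C].
Proof.
have -> : [set c + t | c in C] = (fun x => x - t) @^-1` C.
  apply/seteqP; split => [_ [c Cc <-] /=|x /= Cx]; first by rewrite addrK.
  by exists (x - t) => //; rewrite subrK.
have ct : continuous (fun x : borel G => x - t).
  move=> x; apply: (@continuous_comp _ _ _ (fun x : borel G => (x, t))
    (fun y : borel G * borel G => y.1 - y.2)); last exact: sub_continuous.
  by apply: cvg_pair => /=; [exact: cvg_id|exact: cvg_cst].
move=> mC; rewrite -[X in measurable X]setTI.
apply: (@measurability _ _ _ _ _ _ (@open (borel G))) => // _ [A oA <-].
by rewrite setTI; apply: sub_sigma_algebra; apply: open_comp => // x _; exact: ct.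
Qed.

Section locally_finite_measures.
Context (G : topologicalZmodType) (R : realType).

Definition locally_finite (mu : set (borel G) -> \bar R) :=
  forall K : set (borel G), compact K -> (mu K < +oo)%E.

(* On a second countable locally compact Hausdorff group the regularity often
   required of a Haar measure follows from local finiteness. *)
Definition haar_measure (lam : {measure set (borel G) -> \bar R}) :=
  [/\ locally_finite lam,
      forall (t : borel G) (B : set (borel G)), measurable B ->
        lam [set b + t | b in B] = lam B
    & lam [set: borel G] <> 0%E].

Record lfmeasure := LFMeasure {
  lfmeasure_val :> {measure set (borel G) -> \bar R} ;
  lfmeasureP : locally_finite lfmeasure_val }.

Lemma locally_finite_mzero : locally_finite (@mzero _ (borel G) R).
Proof. by move=> K _; rewrite /mzero ltry. Qed.

HB.instance Definition _ := gen_eqMixin lfmeasure.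
HB.instance Definition _ := gen_choiceMixin lfmeasure.
HB.instance Definition _ :=
  isPointed.Build lfmeasure (LFMeasure locally_finite_mzero).

Definition lfmeasure_eval_preimages : set (set lfmeasure) :=
  \bigcup_(B in @measurable _ (borel G))
    preimage_set_system setT (fun mu : lfmeasure => mu B) measurable.

HB.instance Definition _ :=
  Measurable.copy lfmeasure (g_sigma_algebraType lfmeasure_eval_preimages).

(* [mu (. `&` C) / mu C] if [0 < mu C < +oo], and [P0] otherwise; the infinite
   case does not arise for a locally finite [mu] and a relatively compact [C] *)
Definition mcond (mu : {measure set (borel G) -> \bar R}) (C : set (borel G))
    (mC : measurable C) (P0 : probability (borel G) R) : probability (borel G) R :=
  mnormalize (mrestr mu mC) P0.

End locally_finite_measures.

Section flows.
Context d (Omega : measurableType d) (G : topologicalZmodType) (R : realType).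
Implicit Types (theta : borel G -> Omega -> Omega).
Implicit Types (xi : Omega -> lfmeasure G R).

Local Notation transport_kernel := (R.-ker (Omega * borel G)%type ~> borel G).

Definition measurable_flow theta :=
  [/\ measurable_fun [set: Omega * borel G] (fun p : Omega * borel G => theta p.2 p.1),
      theta 0 = id
    & forall s t : borel G, theta s \o theta t = theta (s + t)].

Definition invariant_random_measure theta xi :=
  measurable_fun [set: Omega] xi /\
  forall (w : Omega) (s : borel G) (B : set (borel G)), measurable B ->
    xi (theta s w) [set b - s | b in B] = xi w B.

Definition weighted_transport_kernel (T : transport_kernel) :=
  forall p : Omega * borel G, locally_finite (T p).

Definition invariant_kernel theta (T : transport_kernel) :=
  forall (s t : borel G) (w : Omega) (B : set (borel G)), measurable B ->
    T (theta t w, s - t) [set b - t | b in B] = T (w, s) B.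

Definition preserving_kernel xi (T : transport_kernel) :=
  forall (w : Omega) (B : set (borel G)), measurable B ->
    (\int[xi w]_s T (w, s) B = xi w B)%E.

Definition bounded_kernel (T : transport_kernel) :=
  (ereal_sup [set T p [set: borel G] | p in [set: Omega * borel G]] < +oo)%E.

Definition invariant_under theta (Q : {measure set Omega -> \bar R})
    (T : transport_kernel) :=
  forall f : Omega -> R, measurable_fun [set: Omega] f -> (forall w, 0 <= f w) ->
    (\int[Q]_w \int[T (w, 0%R)]_t (f (theta t w))%:E = \int[Q]_w (f w)%:E)%E.

(* T_C (t, .) for [mu := xi w] *)
Definition TC (mu : lfmeasure G R) (C : set (borel G)) (mC : measurable C)
    (P0 : probability (borel G) R) (t : borel G) : probability (borel G) R :=
  mcond mu (measurable_translate t mC) P0.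

Definition mass_stationary theta (lam : {measure set (borel G) -> \bar R})
    (P0 : probability (borel G) R) xi (Q : {measure set Omega -> \bar R}) :=
  Q [set w | xi w [set: borel G] = 0%E] = 0%E /\
  forall (C : set (borel G)) (mC : measurable C),
    precompact C -> (0 < lam C)%E -> lam (closure C `\` C°) = 0%E ->
  forall A : set (Omega * borel G), measurable A ->
    (\int[Q]_w \int[mcond lam mC P0]_r \int[TC (xi w) mC P0 (- r)%R]_s
        (\1_A (theta s w, s + r)%R)%:E
     = (Q \x mcond lam mC P0) A)%E.

End flows.

(* Main.v *)
Require Import Defs.
From HB Require Import structures.
From mathcomp Require Import all_boot all_order all_algebra.
From mathcomp Require Import all_classical all_reals all_analysis.
From mathcomp Require Import measurable_realfun.
Set Implicit Arguments.
Unset Strict Implicit.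
Unset Printing Implicit Defensive.
Import Order.TTheory GRing.Theory Num.Theory.
Import numFieldNormedType.Exports KCOMP_SFINITE_KERNEL.
Local Open Scope classical_set_scope.
Local Open Scope ring_scope.

(** Both properties are equivalent to the Mecke equation
      [E_Q [int g (theta_s, - s) xi (ds)] = E_Q [int g (theta_0, s) xi (ds)]]
    for all measurable [g >= 0], which says that the origin may be exchanged
    with a typical point of [xi]. The theorem is the cycle: mass-stationarity
    implies the Mecke equation, the Mecke equation implies invariance under
    preserving kernels, and this invariance implies mass-stationarity.

    Mass-stationarity implies the Mecke equation. Weight the defining equation
    for a window [C] by the mass [xi (C - r)] of the randomly placed window. The
    normalization of [T_C] disappears ([mass_stationary_window]) and what remains
    says that two measures on [Omega * G * G], the laws of [(w, r, s + r)] and of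
    [(theta_s w, r, r - s)] under [Q (dw) xi (w, ds) lam (dr)], agree when both
    group coordinates are restricted to the same window. Only windows with
    a null boundary are available, but these form a ring of sets that generates the Borel
    sets: the sublevel sets of a Urysohn function have null boundaries for almost
    all levels ([continuity_nbhd]). A polarization argument ([measure_polarize])
    passes from one window for both coordinates to a pair of windows, so that the
    two laws are equal ([law_eq]). The difference of the two group coordinates is
    [s] for the first law and [- s] for the second, and [lam (dr)] separates;
    this is the Mecke equation ([window_balance_mecke]).

    The Mecke equation implies invariance ([mecke_invariant_under]). Write [f w]
    as an integral [int h w s xi (w, ds)], where [h w] is a multiple of the
    indicator of a bounded set that [xi w] charges. The Mecke equation turns the
    expectation of the transported [f] into an integral over transports
    [T (s, dt) xi (ds)] from points [s] of [xi], seen from [0]. Preservation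
    replaces it by [xi (dt)], and the Mecke equation leads back to [E_Q [f]].

    Invariance implies mass-stationarity. Given a window [C] and a set [B],
    consider the kernel that, for a point [t], draws [r] from [lam_C] and a point
    [s] of [xi] from the window [C + t - r] around [t]; it moves to [s] if the
    position [s - (t - r)] of [s] in the window lies in [B], and it stays at [t]
    if the position [r] of [t] lies outside [B]. It is invariant and bounded, and
    it preserves [xi] because [t] and [s] play symmetric roles once the windows
    are averaged by the Haar measure ([transfer_TCker]); this rests on the
    invariance of a Haar measure of an abelian group under reflection
    ([haar_reflect]). Invariance of [Q] at the origin then reads
      [Q A = law (A * B) + Q A * lam_C (B^c)],
    with [law] the left-hand side of the equation of mass-stationarity, so that
    [law (A * B) = Q A * lam_C B] ([invariance_mass_law]). The windows without
    mass, where [T_C] is arbitrary, are dropped from the kernel; the case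
    [B = set0] shows that they are negligible ([uncharged_null]). *)

(** * Borel sets of a second countable group *)

Section borel_sets.
Context (G : topologicalZmodType).

Lemma borel_open (U : set (borel G)) : open U -> measurable U.
Proof. exact: sub_sigma_algebra. Qed.

Lemma borel_closed (F : set (borel G)) : closed F -> measurable F.
Proof.
move=> cF; rewrite -(setCK F); apply: measurableC; apply: borel_open.
exact: closed_openC.
Qed.

Lemma second_countable_seq (T : topologicalType) : @second_countable T ->
  exists B : (set T)^nat, (forall n, open (B n)) /\
    forall x (U : set T), nbhs x U -> exists2 n, B n x & B n `<=` U.
Proof.
move=> [B /countable_injP[e injB] [oB baseB]].
pose C n := \bigcup_(U in [set U | B U /\ e U = n]) U.
have CE U : B U -> C (e U) = U.
  move=> BU; apply/seteqP; split => x; last by move=> Ux; exists U.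
  by case=> V [BV eV] Vx; rewrite -(injB V U)// inE.
exists C; split => [n|x U xU].
  by apply: bigcup_open => U [/oB].
have [V [BV Vx] VU] := baseB x U xU.
by exists (e V); rewrite CE.
Qed.

Lemma continuous_measurable_borel d (T : measurableType d)
    (f : T -> borel G) :
  (forall U, open U -> measurable (f @^-1` U)) -> measurable_fun setT f.
Proof.
move=> fU; apply: (@measurability _ _ _ _ _ _ (@open (borel G))) => //.
by move=> _ [A oA <-]; rewrite setTI; exact: fU.
Qed.

(** Second countability is what makes the product of the Borel sigma-algebras
    contain the open sets of the product space. *)
Lemma measurable_open_prod (U : set (borel G * borel G)) :
  @second_countable G -> open U -> measurable U.
Proof.
move=> /second_countable_seq[B [oB baseB]] oU.
have -> : U = \bigcup_n \bigcup_m
    (if `[<B n `*` B m `<=` U>] then B n `*` B m else set0).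
  apply/seteqP; split => [[x y] Uxy|p [n _ [m _]]]; last first.
    by case: asboolP => // + BB; apply.
  have [[V W] /= [Vx Wy] VWU] : nbhs (x, y) U by exact: open_nbhs_nbhs.
  have [n Bnx BnV] := baseB _ _ Vx; have [m Bmy BmW] := baseB _ _ Wy.
  exists n => //; exists m => //; rewrite asboolT// => -[a b] [/= Ba Bb].
  by apply: VWU; split; [exact: BnV|exact: BmW].
apply: bigcupT_measurable => n; apply: bigcupT_measurable => m.
case: ifPn => // _; apply: measurableX; apply: borel_open; exact: oB.
Qed.

Hypothesis G2 : @second_countable G.

Lemma measurable_borelB :
  measurable_fun setT (fun p : borel G * borel G => p.1 - p.2).
Proof.
apply: continuous_measurable_borel => U oU.
apply: measurable_open_prod => //; apply: open_comp => // p _.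
exact: (@sub_continuous G).
Qed.

Lemma measurable_borelN : measurable_fun setT (-%R : borel G -> borel G).
Proof.
apply: continuous_measurable_borel => U oU.
by apply: borel_open; apply: open_comp => // p _; exact: (@opp_continuous G).
Qed.

Lemma measurable_borelD :
  measurable_fun setT (fun p : borel G * borel G => p.1 + p.2).
Proof.
apply: continuous_measurable_borel => U oU.
apply: measurable_open_prod => //; apply: open_comp => // p _.
exact: (@add_continuous G).
Qed.

Lemma measurable_funB_borel d (T : measurableType d) (f g : T -> borel G) :
  measurable_fun setT f -> measurable_fun setT g ->
  measurable_fun setT (fun x => f x - g x).
Proof.
move=> mf mg.
exact: (measurableT_comp measurable_borelB (measurable_fun_pair mf mg)).
Qed.

Lemma measurable_funD_borel d (T : measurableType d) (f g : T -> borel G) :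
  measurable_fun setT f -> measurable_fun setT g ->
  measurable_fun setT (fun x => f x + g x).
Proof.
move=> mf mg.
exact: (measurableT_comp measurable_borelD (measurable_fun_pair mf mg)).
Qed.

Lemma measurable_funN_borel d (T : measurableType d) (f : T -> borel G) :
  measurable_fun setT f -> measurable_fun setT (fun x => - f x).
Proof. by move=> mf; exact: (measurableT_comp measurable_borelN). Qed.

End borel_sets.

Section boundary.
Context (T : topologicalType).
Implicit Types A B : set T.

Definition boundary A := closure A `\` A°.

Lemma boundaryE A : boundary A = closure A `&` closure (~` A).
Proof. by rewrite /boundary setDE closure_setC. Qed.

Lemma boundaryC A : boundary (~` A) = boundary A.
Proof. by rewrite !boundaryE setCK setIC. Qed.

Lemma boundaryU A B : boundary (A `|` B) `<=` boundary A `|` boundary B.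
Proof.
rewrite !boundaryE closureU => x [[Ax|Bx] ABx]; [left|right]; split => //.
- by apply: closureS ABx => y; rewrite setCU => -[].
- by apply: closureS ABx => y; rewrite setCU => -[].
Qed.

Lemma boundaryI A B : boundary (A `&` B) `<=` boundary A `|` boundary B.
Proof.
by rewrite -boundaryC setCI => x /boundaryU; rewrite !boundaryC.
Qed.

End boundary.

(** * Windows with a null boundary *)

Section continuity_sets.
Context (G : topologicalZmodType) (R : realType).
Hypotheses (G_hausdorff : hausdorff_space G)
  (G_locally_compact : locally_compact [set: G])
  (G_second_countable : @second_countable G).
Context (lam : {measure set (borel G) -> \bar R}).
Hypothesis lam_lf : locally_finite lam.
Implicit Types D : set (borel G).

Lemma precompact_lty D : measurable D -> precompact D -> (lam D < +oo)%E.
Proof.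
move=> mD; rewrite precompactE => cD; apply: le_lt_trans (lam_lf cD).
apply: le_measure; rewrite ?inE//; last exact: subset_closure.
by apply: borel_closed; exact: closed_closure.
Qed.

Lemma precompactU D1 D2 : precompact D1 -> precompact D2 ->
  precompact (D1 `|` D2).
Proof. by rewrite !precompactE closureU => c1 c2; exact: compactU. Qed.

Definition continuity_set D :=
  [/\ measurable D, precompact D & lam (boundary D) = 0%E].

Lemma measurable_boundary D : measurable (boundary D).
Proof.
apply: measurableD; first by apply: borel_closed; exact: closed_closure.
by apply: borel_open; exact: open_interior.
Qed.

Let boundary_null D1 D2 D : lam (boundary D1) = 0%E ->
  lam (boundary D2) = 0%E -> boundary D `<=` boundary D1 `|` boundary D2 ->
  lam (boundary D) = 0%E.
Proof.
move=> n1 n2 D12; apply: (subset_measure0 (measurable_boundary D) _ D12).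
  by apply: measurableU; exact: measurable_boundary.
by apply: null_set_setU => //; exact: measurable_boundary.
Qed.

Lemma continuity_set0 : continuity_set set0.
Proof.
split => //; first by rewrite precompactE closure0; exact: compact0.
by rewrite /boundary closure0 set0D measure0.
Qed.

Lemma continuity_setU D1 D2 : continuity_set D1 -> continuity_set D2 ->
  continuity_set (D1 `|` D2).
Proof.
move=> [m1 p1 n1] [m2 p2 n2]; split; first exact: measurableU.
  exact: precompactU.
exact: (boundary_null n1 n2 (@boundaryU _ _ _)).
Qed.

Lemma continuity_setI D1 D2 : continuity_set D1 -> continuity_set D2 ->
  continuity_set (D1 `&` D2).
Proof.
move=> [m1 p1 n1] [m2 p2 n2]; split; first exact: measurableI.
  by apply: precompact_subset p1 => x [].
exact: (boundary_null n1 n2 (@boundaryI _ _ _)).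
Qed.

Lemma continuity_setD D1 D2 : continuity_set D1 -> continuity_set D2 ->
  continuity_set (D1 `\` D2).
Proof.
move=> [m1 p1 n1] [m2 p2 n2]; split; first exact: measurableD.
  by apply: precompact_subset p1 => x [].
apply: (boundary_null n1 n2); rewrite setDE -(boundaryC D2).
exact: boundaryI.
Qed.

(** The level sets of a continuous function are disjoint, hence by Fubini
    almost all of them are null; a Urysohn function that separates a point from
    the complement of a neighbourhood thus has a sublevel set that is a
    continuity set. *)
Lemma continuity_nbhd (x : borel G) (U : set (borel G)) : nbhs x U ->
  exists D, [/\ continuity_set D, open D, D x & D `<=` U].
Proof.
move=> xU.
have [V [xV cV clV]] : exists V : set (borel G),
    [/\ nbhs x V, compact V & closed V].
  have [V + [cV clV]] := @G_locally_compact x I.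
  rewrite /within /= => xV; exists V; split => //.
  by apply: filterS xV => y; exact.
pose W : set (borel G) := (U `&` V)°.
have Wx : W x by apply: filterI.
have WUV : W `<=` U `&` V by exact: interior_subset.
have clW : closed (~` W) by apply: open_closedC; exact: open_interior.
have sep : uniform_separator [set x] (~` W).
  exact: (@locally_compact_completely_regular (borel G) R).
pose f : borel G -> R := @Urysohn (borel G) R [set x] (~` W).
have cf : continuous f by exact: Urysohn_continuous.
have fx : f x = 0 by apply: (Urysohn_sub0 sep); exists x.
have fW y : f y < 1 -> W y.
  move=> fy; apply: contrapT => nWy; move: fy.
  by rewrite (_ : f y = 1) ?ltxx//; apply: (Urysohn_sub1 sep); exists y.
have mf : measurable_fun setT f.
  move=> _; apply: (measurability _ (RGenOpens.measurableE R)) => //.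
  move=> _ [_ [a [b ->]] <-]; rewrite setTI; apply: borel_open.
  by move/continuousP: cf; apply; exact: interval_open.
have mV : measurable V by exact: borel_closed.
have Voo : (lam V < +oo)%E by exact: lam_lf.
pose nu := mfrestr mV Voo.
pose E := [set p : borel G * R | f p.1 = p.2].
have mE : measurable E.
  have mh : measurable_fun setT (fun p : borel G * R => f p.1 - p.2).
    by apply: measurable_funB => //; exact: measurableT_comp.
  rewrite (_ : E = (fun p : borel G * R => f p.1 - p.2) @^-1` [set 0]).
    by rewrite -[X in measurable X]setTI; exact: mh.
  apply/seteqP; split => p; rewrite /E /=; first by move=> ->; rewrite subrr.
  by move/eqP; rewrite subr_eq0 => /eqP.
have null0 : (\int[lebesgue_measure]_t nu (ysection E t) = 0)%E.
  rewrite -(_ : (\int[nu]_y (@lebesgue_measure R) (xsection E y) =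
                 \int[@lebesgue_measure R]_t nu (ysection E t)))%E.
    rewrite integral0_eq// => y _.
    rewrite (_ : xsection E y = [set f y]) ?lebesgue_measure_set1//.
    by apply/seteqP; split => t; rewrite /xsection /= inE /E /=.
  have := @indic_fubini_tonelli _ _ _ _ R nu (@lebesgue_measure R) _ mE.
  by rewrite indic_fubini_tonelli_FE// indic_fubini_tonelli_GE.
have ms : measurable_fun setT (fun t => nu (ysection E t)).
  exact: measurable_fun_ysection.
have [t /andP[t0 t1] nut] : exists2 t : R, 0 < t < 1 & nu (ysection E t) = 0%E.
  apply: contrapT => nt.
  have [|N [mN N0 sN]] :=
      (ae_eq_integral_abs (@lebesgue_measure R) measurableT ms).1.
    by under eq_integral do rewrite gee0_abs//.
  have : ((@lebesgue_measure R) `]0%R, 1%R[%classic <= lebesgue_measure N)%E.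
    apply: le_measure; rewrite ?inE// => t /=; rewrite in_itv/= => t01.
    apply: sN => /= /(_ I) h; apply: nt; exists t => //.
  by rewrite N0 lebesgue_measure_itv/= lte_fin ltr01 oppr0 adde0 leNgt lte_fin
    ltr01.
have oD : open [set y | f y < t].
  by have /continuousP /(_ _ (@open_lt R t)) := cf.
have clD : closure [set y | f y < t] `<=` [set y | f y <= t].
  have clC : closed [set y | f y <= t].
    by have /continuous_closedP /(_ _ (@closed_le R t)) := cf.
  by rewrite [X in _ `<=` X]((closure_id _).1 clC); apply: closureS => y /= /ltW.
have DV : [set y | f y < t] `<=` V.
  by move=> y /= fy; have /fW/WUV[] := lt_trans fy t1.
exists [set y | f y < t]; split => //=; last 2 first.
- by rewrite fx.
- by move=> y /= fy; have /fW/WUV[] := lt_trans fy t1.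
split; first exact: borel_open.
  by exists V.
have {}nut : lam (ysection E t `&` V) = 0%E by exact: nut.
apply: (subset_measure0 (measurable_boundary _) _ _ nut).
  by apply: measurableI => //; exact: measurable_ysection.
move=> y [/clD /= yt]; rewrite ((interior_id _).1 oD) => /negP; rewrite -leNgt => ty.
have fyt : f y = t by apply/eqP; rewrite eq_le yt.
split; first by rewrite /ysection /= inE.
by have /fW/WUV[] : f y < 1 by rewrite fyt.
Qed.

(** A countable base of continuity sets: for each pair of members of a
    countable base, one continuity set squeezed between them. *)
Lemma continuity_base : exists D : (set (borel G))^nat,
  [/\ forall n, continuity_set (D n), forall n, open (D n) &
    forall x (U : set (borel G)), nbhs x U -> exists2 n, D n x & D n `<=` U].
Proof.
have [B [oB baseB]] := second_countable_seq G_second_countable.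
have sq p : {D | continuity_set D /\ open D /\
    ((exists D', [/\ continuity_set D', open D', B p.1 `<=` D' &
                     D' `<=` B p.2]) -> B p.1 `<=` D /\ D `<=` B p.2)}.
  apply: cid.
  have [[D [cD oD BD DB]]|nD] := pselect (exists D', [/\ continuity_set D',
      open D', B p.1 `<=` D' & D' `<=` B p.2]); first by exists D.
  by exists set0; split; [exact: continuity_set0|split; [exact: open0|]].
exists (fun k => if @unpickle (nat * nat)%type k is Some p then sval (sq p)
                 else set0); split => [n|n|x U xU].
- case: unpickle => [p|]; last exact: continuity_set0.
  by have [] := svalP (sq p).
- case: unpickle => [p|]; last exact: open0.
  by have [_ []] := svalP (sq p).
have [m Bmx BmU] := baseB _ _ xU.
have [D [cD oD Dx DBm]] : exists D, [/\ continuity_set D, open D, D x &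
    D `<=` B m] by apply: continuity_nbhd; exact: open_nbhs_nbhs.
have [n Bnx BnD] : exists2 n, B n x & B n `<=` D.
  by apply: baseB; exact: open_nbhs_nbhs.
exists (pickle (n, m)); rewrite pickleK; have [_ [_]] := svalP (sq (n, m)).
  by case; [exists D|move=> + _; apply].
by case; [exists D|move=> _ sB; exact: subset_trans sB BmU].
Qed.

(** Windows with a null boundary are the only ones that mass-stationarity speaks
    of; that they generate the Borel sets makes them sufficient. *)
Lemma continuity_generate : @measurable _ (borel G) = <<s continuity_set >>.
Proof.
have [D [cD oD baseD]] := continuity_base.
apply/seteqP; split; last first.
  apply: smallest_sub; first exact: sigma_algebra_measurable.
  by move=> A [].
apply: smallest_sub; first exact: smallest_sigma_algebra.
move=> U oU.
have -> : U = \bigcup_n (if `[<D n `<=` U>] then D n else set0).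
  apply/seteqP; split => [x Ux|x [n _]]; last by case: asboolP => // + Dx; apply.
  have [n Dnx DnU] := baseD x U (open_nbhs_nbhs (conj oU Ux)).
  by exists n => //; rewrite asboolT.
apply: (@bigcupT_measurable _ (g_sigma_algebraType continuity_set)) => n.
by apply: sub_sigma_algebra; case: ifPn => // _; exact: continuity_set0.
Qed.

Lemma continuity_exhaustion : exists K : (set (borel G))^nat,
  [/\ forall n, continuity_set (K n), {homo K : m n / (m <= n)%N >-> m `<=` n}
    & \bigcup_n K n = setT].
Proof.
have [D [cD oD baseD]] := continuity_base.
exists (fun n => \big[setU/set0]_(i < n) D i); split.
- by move=> n; elim/big_ind: _ => //; [exact: continuity_set0
    |exact: continuity_setU].
- by move=> m n mn; exact: subset_bigsetU.
rewrite -subTset => x _; have [n Dnx _] := baseD x _ filterT.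
by exists n.+1 => //; rewrite big_ord_recr; right.
Qed.

End continuity_sets.

(** * S-finite kernels and measures on products *)

Section kernels.
Context d d' (X : measurableType d) (Y : measurableType d') (R : realType).
Local Open Scope ereal_scope.

Lemma sfinite_of_partition (k : R.-ker X ~> Y) (W : (set (X * Y))^nat) :
  (forall n, measurable (W n)) -> trivIset setT W -> \bigcup_n W n = setT ->
  (forall n U, measurable U ->
     measurable_fun setT (fun x => k x (U `&` xsection (W n) x))) ->
  (forall n, exists r : R, forall x, k x (xsection (W n) x) < r%:E) ->
  exists k' : R.-sfker X ~> Y, forall x, k' x = k x :> {measure set Y -> \bar R}.
Proof.
move=> mW tW cW mk ubW.
pose s n x : {measure set Y -> \bar R} :=
  mrestr (k x) (measurable_xsection x (mW n)).
pose sk n : R.-ker X ~> Y := HB.pack (s n) (isKernel.Build _ _ _ _ _ (s n) (mk n)).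
have s_ub n : measure_fam_uub (s n).
  have [r kr] := ubW n; exists r => x.
  by rewrite /s /= /mrestr setTI.
have kE : exists2 s' : (R.-ker X ~> Y)^nat, forall n, measure_fam_uub (s' n) &
    forall x U, measurable U -> k x U = kseries s' x U.
  exists sk => // x U mU; rewrite /kseries /= /mseries /=.
  rewrite -[in LHS](setIT U) (_ : setT = \bigcup_n xsection (W n) x).
    rewrite setI_bigcupr measure_semi_bigcup//.
    - by move=> n; apply: measurableI => //; exact: measurable_xsection.
    - apply/trivIsetP => i j _ _ ij; rewrite setIACA setIid -xsectionI.
      by move/trivIsetP : tW => ->//; rewrite xsection0 setI0.
    - apply: bigcupT_measurable => n; apply: measurableI => //.
      exact: measurable_xsection.
  by rewrite -xsection_bigcup cW; apply/seteqP; split => y // _; exact: mem_set.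
pose k' : R.-sfker X ~> Y := HB.pack (k : X -> {measure set Y -> \bar R})
  (Kernel.class k) (isSFiniteKernel_subdef.Build _ _ _ _ _ _ kE).
by exists k'.
Qed.

(** A kernel need not be finite uniformly in [x]; cutting the space also
    according to the integer part of the mass of each piece makes it a
    countable sum of bounded kernels. *)
Lemma sfinite_of_exhaustion (k : R.-ker X ~> Y) (K : (set Y)^nat) :
  (forall n, measurable (K n)) -> \bigcup_n K n = setT ->
  (forall n x, k x (K n) < +oo) ->
  exists k' : R.-sfker X ~> Y, forall x, k' x = k x :> {measure set Y -> \bar R}.
Proof.
move=> mK cK Koo.
pose A i j := [set x | k x (K i) < j%:R%:E].
have mA i j : measurable (A i j).
  rewrite /A -[X in measurable X]setTI; apply: emeasurable_fun_infty_o => //.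
  exact/measurable_kernel.
pose B i j := seqDU (A i) j.
have mB i j : measurable (B i j).
  by apply: measurableD => //; apply: bigsetU_measurable.
have mC i : measurable (seqDU K i).
  by apply: measurableD => //; apply: bigsetU_measurable.
pose W n := if @pickle_inv (nat * nat)%type n is Some p
  then B p.1 p.2 `*` seqDU K p.1 else set0.
have xW n x : xsection (W n) x = if @pickle_inv (nat * nat)%type n is Some p
    then (if x \in B p.1 p.2 then seqDU K p.1 else set0) else set0.
  rewrite /W; case: pickle_inv => [[i j]|]; last exact: xsection0.
  case: ifPn => xB; first by rewrite in_xsectionX.
  by rewrite notin_xsectionX.
apply: (@sfinite_of_partition k W).
- by move=> n; rewrite /W; case: pickle_inv => // p; exact: measurableX.
- apply/trivIsetP => m n _ _ mn; apply/seteqP; split => // -[x y].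
  rewrite /W; move: (@pickle_invK (nat * nat)%type m) (@pickle_invK (nat * nat)%type n).
  rewrite /ocancel.
  case: pickle_inv => [p|] /= pm; last by move=> _ [].
  case: pickle_inv => [q|] /= qn; last by case.
  move=> [[/= xp yp] [xq yq]].
  have pq1 : p.1 = q.1 by apply: (@trivIset_seqDU _ K) => //; exists y.
  rewrite pq1 in xp.
  have pq2 : p.2 = q.2.
    by apply: (@trivIset_seqDU _ (A q.1)) => //; exists x.
  by move/eqP: mn; apply; rewrite -pm -qn; congr pickle; case: p q pq1 pq2
    {pm qn xp yp xq yq} => a b [c e] /= -> ->.
- rewrite -subTset => -[x y] _.
  have [i _ yi] : (\bigcup_n seqDU K n) y by rewrite -seqDU_bigcup_eq cK.
  have [j _ xj] : (\bigcup_n B i n) x.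
    rewrite -seqDU_bigcup_eq; exists (Num.truncn (fine (k x (K i)))).+1 => //=.
    have := Koo i x; rewrite /A /=; have := measure_ge0 (k x) (K i).
    by case: (k x (K i)) => // [r _ _|_ _]; rewrite ?ltNyr// lte_fin truncnS_gt.
  by exists (pickle (i, j)) => //; rewrite /W pickleK_inv.
- move=> n U mU; have := xW n; case: pickle_inv => [p|] xWn; last first.
    rewrite (_ : (fun x => _) = cst 0)//.
    by apply/funext => x; rewrite xWn setI0 measure0.
  rewrite (_ : (fun x => _) = (fun x => if x \in B p.1 p.2 then
      k x (U `&` seqDU K p.1) else 0)); last first.
    by apply/funext => x; rewrite xWn; case: ifPn => _; rewrite ?setI0 ?measure0.
  apply: measurable_fun_if => //.
  + by apply: (measurable_fun_bool true); rewrite setTI (_ : _ @^-1` _ = B p.1 p.2)//;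
      apply/seteqP; split => x /=; [exact: set_mem|exact: mem_set].
  + by apply: measurable_funTS; apply/measurable_kernel/measurableI.
- move=> n; have := xW n; case: pickle_inv => [p|] xWn; last first.
    by exists 1%R => x; rewrite xWn measure0.
  exists p.2.+1%:R => x; rewrite xWn; case: ifPn; last by rewrite measure0.
  rewrite inE => -[xA _]; apply: (@le_lt_trans _ _ (k x (K p.1))).
    by apply: le_measure; rewrite ?inE// => y [].
  by apply: lt_le_trans xA _; rewrite lee_fin ler_nat.
Qed.

End kernels.

Section kernel_operations.
Context d d' (X : measurableType d) (Y : measurableType d') (R : realType).
Local Open Scope ereal_scope.

(** A constant kernel: measures thereby enter kernel compositions and the
    interchange of integrals in the same way as kernels. *)
Definition kcst (mu : {measure set Y -> \bar R}) (_ : X) := mu.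

HB.instance Definition _ mu := isKernel.Build _ _ X Y R (kcst mu)
  (fun U _ => measurable_cst (mu U)).

Section kcst_sfinite.
Variable mu : {sfinite_measure set Y -> \bar R}.

Let kcst_sfinite : exists2 s : (R.-ker X ~> Y)^nat,
  forall n, measure_fam_uub (s n) &
  forall x U, measurable U -> kcst mu x U = kseries s x U.
Proof.
exists (fun n => kcst (sfinite_measure_seq mu n)) => [n|x U mU]; last first.
  rewrite /kcst /=; exact: sfinite_measure_seqP.
exists (fine (sfinite_measure_seq mu n setT) + 1)%R => x.
rewrite /kcst EFinD fineK ?fin_num_measure//.
by rewrite lteDl ?fin_num_measure// lte_fin.
Qed.

HB.instance Definition _ := isSFiniteKernel_subdef.Build _ _ X Y R (kcst mu)
  kcst_sfinite.
End kcst_sfinite.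

Section kpull.
Context d1 (X' : measurableType d1) (f : X' -> X).

Definition kpull (mf : measurable_fun setT f) (k : X -> {measure set Y -> \bar R})
  : X' -> {measure set Y -> \bar R} := k \o f.

Variable mf : measurable_fun setT f.

HB.instance Definition _ (k : R.-ker X ~> Y) :=
  isKernel.Build _ _ X' Y R (kpull mf k)
    (fun U mU => measurableT_comp (measurable_kernel k U mU) mf).

Let kpull_sfinite (k : R.-sfker X ~> Y) : exists2 s : (R.-ker X' ~> Y)^nat,
  forall n, measure_fam_uub (s n) &
  forall x U, measurable U -> kpull mf k x U = kseries s x U.
Proof.
have [s ks] := sfinite_kernel k.
exists (fun n => kpull mf (s n)) => [n|x U mU].
  by have [r sr] := measure_uub (s n); exists r => x; exact: sr.
by rewrite /kpull /= ks.
Qed.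

HB.instance Definition _ (k : R.-sfker X ~> Y) :=
  isSFiniteKernel_subdef.Build _ _ X' Y R (kpull mf k) (kpull_sfinite k).

End kpull.

Section kbounded.
Variable k : R.-ker X ~> Y.

(** A copy of [k] that carries its bound, on which the finite-kernel structure
    can be declared. *)
Definition kbounded (_ : measure_fam_uub k) : X -> {measure set Y -> \bar R} := k.

Variable k_uub : measure_fam_uub k.

HB.instance Definition _ :=
  isKernel.Build _ _ X Y R (kbounded k_uub) (measurable_kernel k).
HB.instance Definition _ := Kernel_isFinite.Build _ _ X Y R (kbounded k_uub) k_uub.

End kbounded.

Lemma integral_indicM (mu : {measure set Y -> \bar R}) (C : set Y)
    (f : Y -> \bar R) : \int[mu]_(y in C) f y = \int[mu]_y (f y * (\1_C y)%:E).
Proof.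
rewrite integral_mkcond; apply: eq_integral => y _.
by rewrite patchE indicE; case: ifPn => _; rewrite ?mule1 ?mule0.
Qed.

Lemma integral_indicT (mu : {measure set Y -> \bar R}) (C : set Y) :
  measurable C -> \int[mu]_y (\1_C y)%:E = mu C.
Proof. by move=> mC; rewrite integral_indic// setIT. Qed.

Lemma integral_mrestr (mu : {measure set Y -> \bar R}) (C : set Y)
    (mC : measurable C) (f : Y -> \bar R) :
  (forall y, 0 <= f y) -> measurable_fun setT f ->
  \int[mrestr mu mC]_y f y = \int[mu]_y (f y * (\1_C y)%:E).
Proof.
move=> f0 mf; rewrite -integral_indicM.
transitivity (\int[mrestr mu mC]_(y in C `|` ~` C) f y); first by rewrite setUv.
rewrite ge0_integral_setU//; last 3 first.
- exact: measurableC.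
- by rewrite setUv.
- by apply/disj_setPS; rewrite setICr.
rewrite [X in _ + X](_ : _ = 0); last first.
  apply: null_set_integral => //; [exact: measurableC|exact: measurable_funTS|].
  by rewrite /= /mrestr setICl measure0.
rewrite adde0; apply: eq_measure_integral => A mA AC.
by rewrite /= /mrestr (setIidl AC).
Qed.

Section krestr.
Variables (W : set (X * Y)) (mW : measurable W).

Definition krestr (k : X -> {measure set Y -> \bar R}) (x : X) :
  {measure set Y -> \bar R} := mrestr (k x) (measurable_xsection x mW).

Let measurable_krestr (k : R.-sfker X ~> Y) U : measurable U ->
  measurable_fun setT (krestr k ^~ U).
Proof.
move=> mU; rewrite (_ : (fun x => _) =
    (fun x => \int[k x]_y (\1_((setT `*` U) `&` W) (x, y))%:E)); last first.
  apply/funext => x; have mUW : measurable (U `&` xsection W x).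
    by apply: measurableI => //; exact: measurable_xsection.
  rewrite /krestr /= /mrestr.
  rewrite -[in LHS](setIT (U `&` _)) -integral_indic//.
  apply: eq_integral => y _; rewrite !indicE; congr ((nat_of_bool _)%:R%:E).
  apply/idP/idP => /set_mem.
    by move=> [Uy]; rewrite /xsection /= => /set_mem Wy; apply/mem_set; split.
  move=> [[_ Uy] Wy]; apply/mem_set; split => //.
  by rewrite /xsection /=; exact: mem_set.
apply: (measurable_fun_integral_sfinite_kernel
  (fun p => (\1_((setT `*` U) `&` W) p)%:E)).
  by move=> p; rewrite lee_fin.
apply/measurable_EFinP; apply: measurable_indic.
by apply: measurableI => //; exact: measurableX.
Qed.

HB.instance Definition _ (k : R.-sfker X ~> Y) := isKernel.Build _ _ X Y R (krestr k)
  (measurable_krestr k).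

Let krestr_sfinite (k : R.-sfker X ~> Y) : exists2 s : (R.-ker X ~> Y)^nat,
  forall n, measure_fam_uub (s n) &
  forall x U, measurable U -> krestr k x U = kseries s x U.
Proof.
have [s ks] := sfinite_kernel k.
exists (fun n => krestr (s n)) => [n|x U mU].
  have [r sr] := measure_uub (s n); exists r => x; apply: le_lt_trans (sr x).
  rewrite /krestr /= /mrestr setTI; apply: le_measure; rewrite ?inE//.
  exact: measurable_xsection.
by rewrite /krestr /= /mrestr ks//; apply: measurableI => //;
  exact: measurable_xsection.
Qed.

HB.instance Definition _ (k : R.-sfker X ~> Y) :=
  isSFiniteKernel_subdef.Build _ _ X Y R (krestr k)
  (krestr_sfinite k).

Lemma integral_krestr (k : X -> {measure set Y -> \bar R}) x (f : Y -> \bar R) :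
  (forall y, 0 <= f y) -> measurable_fun setT f ->
  \int[krestr k x]_y f y = \int[k x]_y (f y * (\1_W (x, y))%:E).
Proof.
move=> f0 mf; rewrite /krestr integral_mrestr//.
by apply: eq_integral => y _; rewrite !indicE mem_xsection.
Qed.

End krestr.

End kernel_operations.

Lemma sfinite_kernel_Fubini d1 d2 d3 d4 (X1 : measurableType d1)
    (Y1 : measurableType d2) (X2 : measurableType d3) (Y2 : measurableType d4)
    (R : realType) (k1 : R.-sfker X1 ~> Y1) (k2 : R.-sfker X2 ~> Y2) x1 x2
    (f : Y1 * Y2 -> \bar R) :
  (forall p, 0 <= f p)%E -> measurable_fun setT f ->
  (\int[k1 x1]_y \int[k2 x2]_z f (y, z) = \int[k2 x2]_z \int[k1 x1]_y f (y, z))%E.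
Proof.
move=> f0 mf.
pose m1 : {sfinite_measure set Y1 -> \bar R} := HB.pack (Measure.sort (k1 x1))
  (isSFinite.Build _ _ _ _ (sfinite_kernel_measure k1 x1)).
pose m2 : {sfinite_measure set Y2 -> \bar R} := HB.pack (Measure.sort (k2 x2))
  (isSFinite.Build _ _ _ _ (sfinite_kernel_measure k2 x2)).
exact: (@sfinite_Fubini _ _ _ _ R m1 m2).
Qed.

Section measure_uniqueness.
Local Open Scope ereal_scope.

Lemma measure_eq_cover d (T : measurableType d) (R : realType)
    (m1 m2 : {measure set T -> \bar R}) (g : (set T)^nat) :
  (forall n, measurable (g n)) -> \bigcup_n g n = setT ->
  (forall n A, measurable A -> m1 (g n `&` A) = m2 (g n `&` A)) ->
  forall A, measurable A -> m1 A = m2 A.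
Proof.
move=> mg Ug m12 A mA.
apply: (@g_sigma_algebra_measure_unique_cover _ R T measurable _ g) => //.
- move=> n B; rewrite sigma_algebra_id; last exact: sigma_algebra_measurable.
  exact: m12.
- by rewrite sigma_algebra_id//; exact: sigma_algebra_measurable.
Qed.

Lemma finite_measure_eq_prod d1 d2 (T1 : measurableType d1)
    (T2 : measurableType d2) (R : realType)
    (m1 m2 : {measure set (T1 * T2) -> \bar R}) :
  m1 setT < +oo ->
  (forall A B, measurable A -> measurable B -> m1 (A `*` B) = m2 (A `*` B)) ->
  forall E, measurable E -> m1 E = m2 E.
Proof.
move=> m1oo m12 E mE.
pose rectangles := [set A `*` B | A in @measurable _ T1 & B in @measurable _ T2].
apply: (measure_unique rectangles (fun _ => setT)) => //.
- by rewrite measurable_prod_measurableType.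
- move=> _ _ [A1 mA1 [B1 mB1 <-]] [A2 mA2 [B2 mB2 <-]].
  exists (A1 `&` A2); first exact: measurableI.
  by exists (B1 `&` B2); [exact: measurableI|rewrite setXI].
- by move=> _; exists setT => //; exists setT => //; rewrite setXTT.
- by rewrite -subTset => x _; exists 0%N.
- by move=> _ [A mA [B mB <-]]; exact: m12.
Qed.

(** Restricting both measures to the pieces of a cover reduces the comparison of
    two sigma-finite measures on a product to that of finite ones. *)
Lemma measure_eq_prod d1 d2 (T1 : measurableType d1)
    (T2 : measurableType d2) (R : realType)
    (m1 m2 : {measure set (T1 * T2) -> \bar R}) (E : (set T1)^nat)
    (F : (set T2)^nat) :
  (forall n, measurable (E n)) -> (forall n, measurable (F n)) ->
  \bigcup_n (E n `*` F n) = setT -> (forall n, m1 (E n `*` F n) < +oo) ->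
  (forall n A B, measurable A -> measurable B -> A `<=` E n -> B `<=` F n ->
    m1 (A `*` B) = m2 (A `*` B)) ->
  forall S, measurable S -> m1 S = m2 S.
Proof.
move=> mE mF cEF m1oo m12.
have mEF n : measurable (E n `*` F n) by exact: measurableX.
apply: (measure_eq_cover mEF cEF) => n S mS.
have := @finite_measure_eq_prod _ _ _ _ _ (mrestr m1 (mEF n)) (mrestr m2 (mEF n)).
rewrite /= /mrestr setTI !(setIC (E n `*` F n)); apply => // A B mA mB.
rewrite -setXI; apply: (m12 n); try exact: measurableI.
- by move=> x [].
- by move=> x [].
Qed.

End measure_uniqueness.

Section mcond_integral.
Context (G : topologicalZmodType) (R : realType).
Local Open Scope ereal_scope.

(** Stated without a quotient, so that it holds also when [C] is not charged. *)
Lemma integral_mcond (mu : {measure set (borel G) -> \bar R})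
    (C : set (borel G)) (mC : measurable C) (P0 : probability (borel G) R)
    (f : borel G -> \bar R) : mu C < +oo -> (forall s, 0 <= f s) ->
  measurable_fun setT f ->
  mu C * \int[mcond mu mC P0]_s f s = \int[mu]_s (f s * (\1_C s)%:E).
Proof.
move=> Coo f0 mf; have [C0|C0] := eqVneq (mu C) 0.
  rewrite C0 mul0e -integral_indicM null_set_integral//.
  exact: measurable_funTS.
have Cfin : mu C \is a fin_num by rewrite ge0_fin_numE.
have k0 : (0 <= (fine (mu C))^-1)%R by rewrite invr_ge0 fine_ge0.
pose k : {nonneg R} := NngNum k0.
transitivity (mu C * \int[mscale k (mrestr mu mC)]_s f s).
  congr (_ * _); apply: eq_measure_integral => A mA _.
  rewrite /mcond /= /mnormalize /= /mscale /= /mrestr setTI.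
  by rewrite (negbTE C0) (lt_eqF Coo) /= muleC.
rewrite ge0_integral_mscale// integral_mrestr// muleA.
by rewrite -[X in X * k%:num%:E * _](fineK Cfin) /= -EFinM mulfV ?mul1e// fine_eq0.
Qed.

End mcond_integral.

Lemma indicX (R : realType) (T1 T2 : Type) (A : set T1) (B : set T2) x y :
  \1_(A `*` B) (x, y) = \1_A x * \1_B y :> R.
Proof.
rewrite !indicE -natrM mulnb; congr ((nat_of_bool _)%:R).
apply/idP/andP => [/set_mem[Ax By]|[/set_mem Ax /set_mem By]].
  by split; exact: mem_set.
by apply: mem_set.
Qed.

Lemma fin_muleI (R : realType) (a x y : \bar R) :
  a \is a fin_num -> a != 0%E -> (a * x = a * y -> x = y)%E.
Proof.
move=> fa a0 /(congr1 (fun z => (fine a)^-1%:E * z)%E).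
have c0 : fine a != 0 by rewrite fine_eq0.
by rewrite !muleA -(fineK fa) -EFinM /= mulVf// !mul1e.
Qed.

Section integration_tools.
Local Open Scope ereal_scope.
Context d1 d2 d3 (T1 : measurableType d1) (T2 : measurableType d2)
  (T3 : measurableType d3) (R : realType).

Lemma measurable_fun_comp2 d4 (T4 : measurableType d4) (h : T1 -> T2 -> T4)
    (f : T3 -> T1) (g : T3 -> T2) :
  measurable_fun setT (fun p => h p.1 p.2) -> measurable_fun setT f ->
  measurable_fun setT g -> measurable_fun setT (fun x => h (f x) (g x)).
Proof.
by move=> mh mf mg; exact: (measurableT_comp mh (measurable_fun_pair mf mg)).
Qed.

Lemma measurable_integral_kernel (k : R.-sfker T1 ~> T2) (f : T3 -> T1)
    (g : T3 -> T2 -> \bar R) :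
  measurable_fun setT f -> (forall x y, 0 <= g x y) ->
  measurable_fun setT (fun p => g p.1 p.2) ->
  measurable_fun setT (fun x => \int[k (f x)]_y g x y).
Proof.
move=> mf g0 mg; apply: (measurable_fun_integral_sfinite_kernel
  (fun p : T3 * T2 => g p.1 p.2) (kpull mf k)) => // -[x y]; exact: g0.
Qed.

Lemma measurable_integral_sfinite (m : {sfinite_measure set T2 -> \bar R})
    (g : T3 -> T2 -> \bar R) :
  (forall x y, 0 <= g x y) -> measurable_fun setT (fun p => g p.1 p.2) ->
  measurable_fun setT (fun x => \int[m]_y g x y).
Proof.
move=> g0 mg; apply: (measurable_fun_integral_sfinite_kernel
  (fun p : T3 * T2 => g p.1 p.2) (kcst m)) => // -[x y]; exact: g0.
Qed.

Lemma measurable_indic_comp (A : set T1) (f : T3 -> T1) :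
  measurable A -> measurable_fun setT f ->
  measurable_fun setT (fun x => (\1_A (f x))%:E : \bar R).
Proof.
by move=> mA mf; apply/measurable_EFinP; apply: measurableT_comp mf.
Qed.

Lemma ge0_integral_eq_off_null (m : {measure set T1 -> \bar R}) (N : set T1)
    (f g : T1 -> \bar R) :
  measurable N -> m N = 0 -> measurable_fun setT f -> measurable_fun setT g ->
  (forall x, 0 <= f x) -> (forall x, 0 <= g x) ->
  (forall x, ~ N x -> f x = g x) -> \int[m]_x f x = \int[m]_x g x.
Proof.
move=> mN N0 mf mg f0 g0 fg; apply: ge0_ae_eq_integral => //.
exists N; split => // x /= nfg; apply: contrapT => Nx.
by apply: nfg => _; exact: fg.
Qed.

End integration_tools.

Lemma sfinite_kernel_Fubini_curry d1 d2 d3 d4 (X1 : measurableType d1)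
    (Y1 : measurableType d2) (X2 : measurableType d3) (Y2 : measurableType d4)
    (R : realType) (k1 : R.-sfker X1 ~> Y1) (k2 : R.-sfker X2 ~> Y2) x1 x2
    (f : Y1 -> Y2 -> \bar R) :
  (forall y z, 0 <= f y z)%E -> measurable_fun setT (fun p => f p.1 p.2) ->
  (\int[k1 x1]_y \int[k2 x2]_z f y z = \int[k2 x2]_z \int[k1 x1]_y f y z)%E.
Proof.
move=> f0 mf.
exact: (sfinite_kernel_Fubini k1 k2 x1 x2 (f := fun p => f p.1 p.2)).
Qed.

Lemma sfinite_cst_Fubini d1 d2 d3 (X1 : measurableType d1)
    (Y1 : measurableType d2) (Y2 : measurableType d3)
    (R : realType) (k : R.-sfker X1 ~> Y1) (m : {sfinite_measure set Y2 -> \bar R})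
    x (f : Y1 -> Y2 -> \bar R) :
  (forall y z, 0 <= f y z)%E -> measurable_fun setT (fun p => f p.1 p.2) ->
  (\int[k x]_y \int[m]_z f y z = \int[m]_z \int[k x]_y f y z)%E.
Proof. exact: (@sfinite_kernel_Fubini_curry _ _ _ _ _ _ _ _ R k (@kcst _ _ unit _ R m) x tt). Qed.

(** * Translation and reflection of a Haar measure *)

Section translations.
Context (G : topologicalZmodType) (R : realType).
Hypothesis G2 : @second_countable G.
Local Open Scope ereal_scope.
Implicit Types (m : {measure set (borel G) -> \bar R}) (f : borel G -> \bar R).

Lemma integral_translate m1 m2 (t : borel G) f :
  (forall B : set (borel G), measurable B -> m1 [set (b - t)%R | b in B] = m2 B) ->
  measurable_fun setT f -> (forall s, 0 <= f s) ->
  \int[m1]_s f s = \int[m2]_s f (s - t)%R.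
Proof.
move=> m12 mf f0.
have mt : measurable_fun setT (fun s : borel G => s - t)%R.
  exact: measurable_funB_borel.
transitivity (\int[pushforward m2 (fun s : borel G => s - t)%R]_s f s); last first.
  by rewrite ge0_integral_pushforward.
apply: eq_measure_integral => A mA _.
transitivity (m2 ((fun s : borel G => s - t)%R @^-1` A)); last by [].
rewrite -m12; last by rewrite -[X in measurable X]setTI; exact: mt.
congr (m1 _); apply/seteqP; split => [s As|_ [s As <-]//].
by exists (s + t)%R; rewrite /= ?addrK.
Qed.

Variable lam : {sfinite_measure set (borel G) -> \bar R}.
Hypothesis lam_inv : forall (t : borel G) (B : set (borel G)), measurable B ->
  lam [set (b + t)%R | b in B] = lam B.

Lemma haar_shift (t : borel G) f : measurable_fun setT f ->
  (forall s, 0 <= f s) -> \int[lam]_s f (s + t)%R = \int[lam]_s f s.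
Proof.
move=> mf f0; rewrite [RHS](@integral_translate lam lam (- t)%R)//.
  by under [RHS]eq_integral do rewrite opprK.
move=> B mB; transitivity (lam [set (b + t)%R | b in B]); last exact: lam_inv.
by congr (lam _); apply/seteqP; split => _ [b Bb <-]; exists b; rewrite ?opprK.
Qed.

(** In an abelian group the two ways of integrating [f (x - y)] over
    [y \in K] first in [x] or first in [y - x] give [lam K] times the integral
    of [f], respectively of the reflection of [f]. *)
Lemma haar_reflect (K : set (borel G)) f : measurable K ->
  lam K != 0 -> lam K < +oo ->
  measurable_fun setT f -> (forall s, 0 <= f s) ->
  \int[lam]_s f (- s)%R = \int[lam]_s f s.
Proof.
move=> mK K0 Koo mf f0.
have KE : \int[lam]_y (\1_K y)%:E = lam K by rewrite integral_indic// setIT.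
have mNf : measurable_fun setT (fun s : borel G => f (- s)%R).
  by apply: measurableT_comp mf _; exact: measurable_funN_borel.
have m1K := measurable_indic_comp (R := R) mK (@measurable_id _ _ setT).
have fin : lam K \is a fin_num by rewrite ge0_fin_numE.
apply: (fin_muleI fin K0).
rewrite -!KE.
transitivity (\int[lam]_x \int[lam]_y (f (x - y)%R * (\1_K y)%:E)).
  transitivity (\int[lam]_x \int[lam]_u (f (- u)%R * (\1_K (u + x)%R)%:E)).
    rewrite (@sfinite_cst_Fubini _ _ _ _ _ _ _ (@kcst _ _ unit _ R lam) lam tt
      (fun x u => f (- u)%R * (\1_K (u + x)%R)%:E))//; last 2 first.
    - by move=> x u; rewrite mule_ge0// lee_fin.
    - apply: emeasurable_funM; first exact: measurableT_comp mNf _.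
      by apply: measurable_indic_comp => //; exact: measurable_funD_borel.
    rewrite /kcst muleC -ge0_integralZr//; last by rewrite KE.
    apply: eq_integral => u _; rewrite ge0_integralZl//; last first.
      by apply: measurable_indic_comp => //; exact: measurable_funD_borel.
    congr (_ * _); rewrite -(@haar_shift u (fun x => (\1_K x)%:E))//.
    by rewrite /kcst; apply: eq_integral => x _; rewrite addrC.
  apply: eq_integral => x _.
  rewrite -(@haar_shift (- x)%R (fun u => f (- u)%R * (\1_K (u + x)%R)%:E))//.
  - by apply: eq_integral => y _; rewrite opprB subrK.
  - apply: emeasurable_funM => //; apply: measurable_indic_comp => //.
    exact: measurable_funD_borel.
  - by move=> u; rewrite mule_ge0// lee_fin.
rewrite (@sfinite_cst_Fubini _ _ _ _ _ _ _ (@kcst _ _ unit _ R lam) lam tt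
  (fun x y => f (x - y)%R * (\1_K y)%:E))//; last 2 first.
- by move=> x u; rewrite mule_ge0// lee_fin.
- apply: emeasurable_funM.
    by apply: measurableT_comp mf _; exact: measurable_funB_borel.
  exact: measurable_indic_comp.
rewrite /kcst muleC -ge0_integralZl//; last by rewrite integral_ge0.
apply: eq_integral => y _; rewrite ge0_integralZr//; last first.
  by apply: measurableT_comp mf _; exact: measurable_funB_borel.
by congr (_ * _); rewrite (@haar_shift (- y)%R).
Qed.

End translations.

Lemma precompact_exhaustion (R : realType) (G : topologicalZmodType) :
  hausdorff_space G -> locally_compact [set: G] -> @second_countable G ->
  exists K : (set (borel G))^nat, [/\ forall n, measurable (K n),
    forall n, precompact (K n), {homo K : m n / (m <= n)%N >-> m `<=` n}
    & \bigcup_n K n = setT].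
Proof.
move=> hG lG G2.
have [K [cK mK UK]] :=
  continuity_exhaustion hG lG G2 (@locally_finite_mzero G R).
by exists K; split => // n; have [] := cK n.
Qed.

(** * The Mecke equation implies invariance under preserving kernels *)

Section mecke.
Context d (Omega : measurableType d) (G : topologicalZmodType) (R : realType).
Hypotheses (G_hausdorff : hausdorff_space G)
  (G_locally_compact : locally_compact [set: G])
  (G2 : @second_countable G).
Context (theta : borel G -> Omega -> Omega) (theta_flow : measurable_flow theta).
Context (X : R.-sfker Omega ~> borel G).
Hypothesis X_lf : forall w, locally_finite (X w).
Hypothesis X_inv : forall (w : Omega) (s : borel G) (B : set (borel G)),
  measurable B -> X (theta s w) [set b - s | b in B] = X w B.
Context (Q : {sigma_finite_measure set Omega -> \bar R}).
Local Open Scope ereal_scope.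

(** The equation that characterizes the Palm measures of a random measure: the
    origin may be moved to a point of [X]. *)
Definition mecke_equation :=
  forall g : Omega -> borel G -> \bar R,
    measurable_fun setT (fun p : Omega * borel G => g p.1 p.2) ->
    (forall w s, 0 <= g w s) ->
    \int[Q]_w \int[X w]_s g (theta s w) (- s)%R = \int[Q]_w \int[X w]_s g w s.

Lemma measurable_theta d' (T : measurableType d') (f : T -> borel G)
    (g : T -> Omega) : measurable_fun setT f -> measurable_fun setT g ->
  measurable_fun setT (fun x => theta (f x) (g x)).
Proof.
move=> mf mg; have [mth _ _] := theta_flow.
exact: (measurableT_comp mth (measurable_fun_pair mg mf)).
Qed.

Lemma thetaD s t w : theta s (theta t w) = theta (s + t)%R w.
Proof. by have [_ _ <-] := theta_flow. Qed.

Lemma theta0 w : theta 0%R w = w.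
Proof. by have [_ -> _] := theta_flow. Qed.

Lemma integral_theta w t (f : borel G -> \bar R) : measurable_fun setT f ->
  (forall s, 0 <= f s) ->
  \int[X (theta t w)]_s f s = \int[X w]_s f (s - t)%R.
Proof.
by move=> mf f0; apply: integral_translate => // B mB; exact: X_inv.
Qed.

Lemma X_thetaT w t : X (theta t w) setT = X w setT.
Proof.
rewrite -(X_inv w t measurableT); congr (X _ _); apply/esym.
rewrite -subTset => x _.
by exists (x + t)%R; rewrite ?addrK.
Qed.

Lemma measurable_X B : measurable B -> measurable_fun setT (X ^~ B).
Proof. exact: measurable_kernel. Qed.

(** Dividing by the mass of the section of [W] turns a function of [w] into an
    integral with respect to [X w], to which the Mecke equation applies. *)
Lemma charged_window : exists W : set (Omega * borel G), measurable W /\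
  forall w, X w (xsection W w) < +oo /\
    (X w setT != 0 -> X w (xsection W w) != 0).
Proof.
have [K [mK pK _ cK]] := precompact_exhaustion R G_hausdorff G_locally_compact G2.
(* The window of [w] is the first [K n] that [X w] charges. *)
pose E n := [set w | X w (K n) != 0].
have mE n : measurable (E n).
  rewrite (_ : E n = ~` ((X ^~ (K n)) @^-1` [set 0])); last first.
    by apply/seteqP; split => w /= /eqP.
  apply: measurableC; rewrite -[X in measurable X]setTI.
  by apply: measurable_X => //.
have mS n : measurable (seqDU E n).
  by apply: measurableD => //; exact: bigsetU_measurable.
exists (\bigcup_n (seqDU E n `*` K n)); split.
  by apply: bigcupT_measurable => n; exact: measurableX.
have secE n w : seqDU E n w ->
    xsection (\bigcup_n (seqDU E n `*` K n)) w = K n.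
  move=> wn; rewrite xsection_bigcup; apply/seteqP; split => [y [m _]|y Kny].
    have [wm|wm] := boolP (w \in seqDU E m); last by rewrite notin_xsectionX.
    rewrite in_xsectionX// => Kmy; rewrite (_ : n = m)//.
    by apply: (@trivIset_seqDU _ E) => //; exists w; split => //; exact: set_mem.
  by exists n => //; rewrite in_xsectionX//; exact: mem_set.
have sec0 w : (forall n, ~ seqDU E n w) ->
    xsection (\bigcup_n (seqDU E n `*` K n)) w = set0.
  move=> nw; rewrite xsection_bigcup bigcup0// => n _.
  by rewrite notin_xsectionX//; apply/negP => /set_mem/nw.
move=> w; have [[n wn]|/forallNP nw] := pselect (exists n, seqDU E n w).
  rewrite (secE n w wn); split; first exact: precompact_lty.
  by case: wn.
rewrite (sec0 w nw) measure0; split => // /eqP Xw; exfalso; apply: Xw.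
apply/eqP; rewrite -measure_le0 -cK.
apply: (@le_trans _ _ (\sum_(n <oo) X w (K n))).
  by apply: measure_sigma_subadditive => //; rewrite cK.
rewrite eseries0// => n _ _; apply: contrapT => /eqP Xn.
have : (\bigcup_n seqDU E n) w by rewrite -seqDU_bigcup_eq; exists n.
by case=> m _ /nw.
Qed.

Section invariance.
Hypothesis Q_X : Q [set w | X w setT = 0] = 0.
Hypothesis X_mecke : mecke_equation.
Variable T : R.-ker (Omega * borel G)%type ~> borel G.
Hypotheses (T_bounded : bounded_kernel T) (T_inv : invariant_kernel theta T).
Hypothesis T_preserving : forall (w : Omega) (B : set (borel G)), measurable B ->
  \int[X w]_s T (w, s) B = X w B.

(** The Mecke equation is used twice: it moves the origin from [0] to a point
    [s] of [X], where the invariance and the preservation property of [T] turn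
    [T (s, dt) X (ds)] into [X (dt)], and then moves it back from [t] to [0].
    The weight [F] of the window makes an integral with respect to [X] out of
    the integrand [f]. *)
Lemma mecke_invariant_under : invariant_under theta Q T.
Proof.
move=> f mf f0.
have T_uub : measure_fam_uub T.
  have Tfin p : T p setT <= ereal_sup [set T p [set: borel G] | p in setT].
    by apply: ereal_sup_ubound; exists p.
  have sfin : ereal_sup [set T p [set: borel G] | p in setT] \is a fin_num.
    rewrite ge0_fin_numE//; apply: le_trans (Tfin point); exact: measure_ge0.
  exists (fine (ereal_sup [set T p [set: borel G] | p in setT]) + 1)%R => p.
  apply: (le_lt_trans (Tfin p)); rewrite EFinD fineK//.
  by rewrite lteDl// lte_fin.
pose Tf : R.-fker (Omega * borel G)%type ~> borel G := kbounded T_uub.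
have [W [mW XW]] := charged_window.
pose Z w := X w (xsection W w).
have ZE w : Z w = \int[X w]_s (\1_W (w, s))%:E.
  have := @integral_indic _ _ _ (X w) setT measurableT (xsection W w)
    (measurable_xsection w mW).
  rewrite setIT -/(Z w) => <-.
  by apply: eq_integral => s _; rewrite !indicE mem_xsection.
have mZ : measurable_fun setT Z.
  rewrite (_ : Z = (fun w => \int[X w]_s (\1_W (w, s))%:E)); last exact/funext.
  apply: (measurable_integral_kernel X (f := id)) => //.
  by apply: measurable_indic_comp => //; exact: measurable_fun_pair.
(* The reciprocal is written as a power, which is a measurable function. *)
pose F w := (f w * (fine (Z w)) `^ (-1))%R.
have F0 w : (0 <= F w)%R by rewrite mulr_ge0// powR_ge0.
have mF : measurable_fun setT F.
  apply: measurable_funM => //; apply: (measurableT_comp (measurable_powR _)).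
  exact: (measurableT_comp (fine_measurable measurableT)).
have FZ w : X w setT != 0 -> (F w)%:E * Z w = (f w)%:E.
  move=> /(XW w).2 Z0; have Zfin : Z w \is a fin_num.
    by rewrite ge0_fin_numE// (XW w).1.
  rewrite -(fineK Zfin) -EFinM /F powR_inv1; last by rewrite fine_ge0.
  by rewrite mulfVK// fine_eq0.
pose h w s : \bar R := (F w)%:E * (\1_W (w, s))%:E.
have h0 w s : 0 <= h w s by rewrite mule_ge0// lee_fin.
have mh : measurable_fun setT (fun p : Omega * borel G => h p.1 p.2).
  apply: emeasurable_funM.
    by apply/measurable_EFinP; exact: (measurableT_comp mF).
  by apply: measurable_indic_comp => //; exact: measurable_fun_pair.
have hX w : X w setT != 0 -> \int[X w]_s h w s = (f w)%:E.
  move=> Xw; rewrite /h ge0_integralZl//; first by rewrite -ZE FZ.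
  - by apply: measurable_indic_comp => //; exact: measurable_fun_pair.
  - by rewrite lee_fin.
have mN : measurable [set w | X w setT = 0].
  rewrite -[X in measurable X]setTI.
  rewrite (_ : [set w | X w setT = 0] = (X ^~ setT) @^-1` [set 0])//.
  by apply: measurable_X => //.
pose H w s := \int[Tf (w, 0%R)]_t h (theta t w) (s - t)%R.
have H0 w s : 0 <= H w s by apply: integral_ge0.
have mH : measurable_fun setT (fun p : Omega * borel G => H p.1 p.2).
  apply: (measurable_integral_kernel Tf
    (f := fun p : Omega * borel G => (p.1, 0%R : borel G))
    (g := fun (p : Omega * borel G) t => h (theta t p.1) (p.2 - t)%R)) => //.
    exact: measurable_fun_pair.
  apply: (measurable_fun_comp2 mh).
    by apply: measurable_theta => //; exact: measurableT_comp.
  by apply: measurable_funB_borel => //; exact: measurableT_comp.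
transitivity (\int[Q]_w \int[X w]_s H w s).
  apply: (ge0_integral_eq_off_null mN Q_X) => //.
  - apply: (measurable_integral_kernel Tf (f := fun w => (w, 0%R : borel G))
      (g := fun w t => (f (theta t w))%:E)) => //.
    + by move=> w t; rewrite lee_fin.
    + apply/measurable_EFinP; apply: (measurableT_comp mf).
      exact: measurable_theta.
  - exact: (measurable_integral_kernel X (f := id)).
  - by move=> w; apply: integral_ge0 => t _; rewrite lee_fin.
  - by move=> w; apply: integral_ge0.
  move=> w Xw; rewrite /H.
  rewrite (sfinite_kernel_Fubini_curry X Tf w (w, 0%R)
    (f := fun s t => h (theta t w) (s - t)%R))//; last first.
    apply: (measurable_fun_comp2 mh); first exact: measurable_theta.
    exact: measurable_funB_borel.
  apply: eq_integral => t _.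
  rewrite -(@integral_theta w t (h (theta t w)))//; last first.
    exact: (measurable_fun_comp2 mh).
  by rewrite hX// X_thetaT; apply/eqP.
rewrite -(X_mecke mH H0).
transitivity (\int[Q]_w \int[X w]_t h (theta t w) (- t)%R).
  apply: eq_integral => w _.
  pose phi t := h (theta t w) (- t)%R.
  have mphi : measurable_fun setT phi.
    apply: (measurable_fun_comp2 mh); first exact: measurable_theta.
    exact: measurable_funN_borel.
  transitivity (\int[kcomp X Tf w]_t phi t); last first.
    by apply: eq_measure_integral => A mA _; exact: T_preserving.
  rewrite integral_kcomp//; last by move=> t; exact: h0.
  apply: eq_integral => s _; rewrite /H.
  rewrite (@integral_translate _ _ G2 _ (T (w, s)) s).
  - by apply: eq_integral => t _; rewrite thetaD subrK opprB addKr.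
  - move=> B mB; rewrite -[in LHS](subrr s); exact: T_inv.
  - apply: (measurable_fun_comp2 mh).
      by apply: measurable_theta.
    exact: measurable_funB_borel.
  - by move=> t.
rewrite (X_mecke mh h0); apply: (ge0_integral_eq_off_null mN Q_X) => //.
- exact: (measurable_integral_kernel X (f := id)).
- exact/measurable_EFinP.
- by move=> w; apply: integral_ge0.
- by move=> w /eqP; exact: hX.
Qed.

End invariance.
End mecke.

(** * Choosing a point at random in a window *)

Section conditioning_kernel.
Context d (Omega : measurableType d) (G : topologicalZmodType) (R : realType).
Hypothesis (G2 : @second_countable G).
Context (theta : borel G -> Omega -> Omega) (theta_flow : measurable_flow theta).
Context (X : R.-sfker Omega ~> borel G).
Hypothesis X_lf : forall w, locally_finite (X w).
Hypothesis X_inv : forall (w : Omega) (s : borel G) (B : set (borel G)),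
  measurable B -> X (theta s w) [set b - s | b in B] = X w B.
Context (C : set (borel G)) (mC : measurable C) (pC : precompact C).
Context (P0 : probability (borel G) R).
Local Open Scope ereal_scope.

Lemma translateE (u : borel G) (B : set (borel G)) :
  [set (c + u)%R | c in B] = (fun s => s - u)%R @^-1` B.
Proof.
apply/seteqP; split => [_ [c Bc <-] /=|s /= Bs]; first by rewrite addrK.
by exists (s - u)%R => //; rewrite subrK.
Qed.

Lemma mem_translate (u s : borel G) (B : set (borel G)) :
  \1_[set (c + u)%R | c in B] s = \1_B (s - u)%R :> R.
Proof. by rewrite translateE. Qed.

Definition translate_restr (p : Omega * borel G) : {measure set borel G -> \bar R} :=
  mrestr (X p.1) (measurable_translate p.2 mC).

Let measurable_translate_restr U : measurable U ->
  measurable_fun setT (translate_restr ^~ U).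
Proof.
move=> mU; rewrite (_ : (fun p => _) =
    (fun p => \int[X p.1]_s ((\1_U s)%:E * (\1_C (s - p.2)%R)%:E))); last first.
  apply/funext => p; rewrite /translate_restr /= /mrestr.
  rewrite -integral_indic//; last exact: measurable_translate.
  rewrite integral_indicM; apply: eq_integral => s _.
  by rewrite mem_translate.
apply: (measurable_integral_kernel X (f := fun p : Omega * borel G => p.1)
  (g := fun (p : Omega * borel G) s => (\1_U s)%:E * (\1_C (s - p.2)%R)%:E)) => //.
  exact: measurable_fst.
apply: emeasurable_funM; apply: measurable_indic_comp => //.
by apply: measurable_funB_borel => //; exact: measurableT_comp.
Qed.

HB.instance Definition _ := isKernel.Build _ _ _ _ R translate_restr
  measurable_translate_restr.

(** The conditional law [T_C], as a kernel in [(w, u)]. *)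
Definition TCker := knormalize translate_restr P0.

Definition window_mass (w : Omega) (u : borel G) : \bar R :=
  X w [set (c + u)%R | c in C].

Lemma window_massE w u : window_mass w u = X (theta u w) C.
Proof.
rewrite /window_mass -[LHS](X_inv w u (measurable_translate u mC)).
congr (X _ _); apply/seteqP; split => [_ [_ [c Cc <-] <-]|c Cc].
  by rewrite addrK.
by exists (c + u)%R; [exists c|rewrite addrK].
Qed.

Lemma window_mass_lty w u : window_mass w u < +oo.
Proof. by rewrite window_massE; exact: precompact_lty. Qed.

Lemma window_mass_theta w u v :
  window_mass (theta u w) (v - u)%R = window_mass w v.
Proof. by rewrite !window_massE (thetaD theta_flow) subrK. Qed.

(** The conditional law [T_C] is arbitrary on windows without mass; this factor
    discards them. *)
Definition charged (w : Omega) (u : borel G) : \bar R :=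
  (\1_[set p | window_mass p.1 p.2 != 0] (w, u))%:E.

Lemma charged_ge0 w u : 0 <= charged w u.
Proof. by rewrite lee_fin. Qed.

Lemma chargedE w u : charged w u = if window_mass w u == 0 then 0 else 1.
Proof.
rewrite /charged indicE; case: eqVneq => h.
  by rewrite memNset//= h eqxx.
by rewrite mem_set.
Qed.

Lemma measurable_charged_set :
  measurable [set p : Omega * borel G | window_mass p.1 p.2 != 0].
Proof.
rewrite (_ : mkset _ = ~` ((fun p => X (theta p.2 p.1) C) @^-1` [set 0])).
  apply: measurableC; rewrite -[X in measurable X]setTI.
  have : measurable_fun setT (fun p : Omega * borel G => X (theta p.2 p.1) C).
    by apply: (measurableT_comp (measurable_kernel X _ mC)); exact: measurable_theta.
  by apply.
by apply/seteqP; split => p /=; rewrite window_massE => /eqP.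
Qed.

Lemma measurable_charged d' (T : measurableType d') (f : T -> Omega)
    (g : T -> borel G) : measurable_fun setT f -> measurable_fun setT g ->
  measurable_fun setT (fun x => charged (f x) (g x)).
Proof.
move=> mf mg; apply: measurable_indic_comp; first exact: measurable_charged_set.
exact: measurable_fun_pair.
Qed.

Lemma integral_TCker w u (f : borel G -> \bar R) : (forall s, 0 <= f s) ->
  measurable_fun setT f ->
  window_mass w u * \int[TCker (w, u)]_s f s =
  \int[X w]_s (f s * (\1_C (s - u)%R)%:E).
Proof.
move=> f0 mf; rewrite (integral_mcond (measurable_translate u mC) P0)//.
  by apply: eq_integral => s _; rewrite mem_translate.
exact: window_mass_lty.
Qed.

Lemma integral_uncharged w u (f : borel G -> \bar R) : (forall s, 0 <= f s) ->
  measurable_fun setT f ->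
  charged w u * \int[X w]_s (f s * (\1_C (s - u)%R)%:E) =
  \int[X w]_s (f s * (\1_C (s - u)%R)%:E).
Proof.
move=> f0 mf; rewrite -integral_TCker// chargedE.
by case: eqVneq => [->|_]; rewrite ?mul0e ?mul1e.
Qed.

Section transfer.
Context (lam : {sigma_finite_measure set (borel G) -> \bar R}).
Hypothesis lam_inv : forall (t : borel G) (B : set (borel G)), measurable B ->
  lam [set (b + t)%R | b in B] = lam B.
Hypothesis lamC0 : lam C != 0.
Hypothesis lamC_lty : lam C < +oo.
Let ell := mcond lam mC P0.
Let lamC_fin : lam C \is a fin_num. Proof. by rewrite ge0_fin_numE. Qed.

(** Averaging over the windows [C + t - r] around [t], with [r] distributed
    according to [lam_C], is averaging over all windows [C + u] that contain [t]
    with respect to [lam (du)]: the substitution [u = t - r] is a reflection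
    followed by a translation, and [lam] is invariant under both. *)
Lemma transfer w (g : borel G -> borel G -> \bar R) :
  (forall u t, 0 <= g u t) -> measurable_fun setT (fun p => g p.1 p.2) ->
  lam C * \int[X w]_t \int[ell]_r g (t - r)%R t =
  \int[lam]_u \int[X w]_t (g u t * (\1_C (t - u)%R)%:E).
Proof.
move=> g0 mg.
have mg1 t : measurable_fun setT (fun r : borel G => g (t - r)%R t).
  by apply: (measurable_fun_comp2 mg) => //; exact: measurable_funB_borel.
rewrite -ge0_integralZl//; last 2 first.
- apply: (measurable_integral_sfinite ell
    (g := fun t r : borel G => g (t - r)%R t)) => //.
  by apply: (measurable_fun_comp2 mg) => //; exact: measurable_funB_borel.
- by move=> t _; exact: integral_ge0.
rewrite -(sfinite_cst_Fubini X lam w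
  (f := fun t u : borel G => g u t * (\1_C (t - u)%R)%:E)); last 2 first.
- by move=> t u; rewrite mule_ge0// lee_fin.
- apply: emeasurable_funM; first exact: (measurable_fun_comp2 mg).
  by apply: measurable_indic_comp => //; exact: measurable_funB_borel.
apply: eq_integral => t _; rewrite integral_mcond//.
have mF : measurable_fun setT (fun r : borel G =>
    g (t + r)%R t * (\1_C (- r)%R)%:E).
  apply: emeasurable_funM.
    by apply: (measurable_fun_comp2 mg) => //; exact: measurable_funD_borel.
  by apply: measurable_indic_comp => //; exact: measurable_funN_borel.
have F0 r : 0 <= g (t + r)%R t * (\1_C (- r)%R)%:E by rewrite mule_ge0// lee_fin.
rewrite -(haar_reflect G2 lam_inv mC)//; last 2 first.
- by apply: emeasurable_funM => //; exact/measurable_EFinP/measurable_indic.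
- by move=> r; rewrite mule_ge0// lee_fin.
under eq_integral do rewrite opprK.
rewrite -(haar_shift G2 lam_inv (- t)%R mF F0).
by apply: eq_integral => u _; rewrite opprB (addrC u) addrA subrr add0r.
Qed.

(** A window without mass contributes nothing to an integral with respect to
    [X] over the points that it contains. *)
Lemma transfer_charged w (g : borel G -> borel G -> \bar R) :
  (forall u t, 0 <= g u t) -> measurable_fun setT (fun p => g p.1 p.2) ->
  \int[X w]_t \int[ell]_r (charged w (t - r)%R * g (t - r)%R t) =
  \int[X w]_t \int[ell]_r g (t - r)%R t.
Proof.
move=> g0 mg; apply: (fin_muleI lamC_fin lamC0).
rewrite (transfer w (g := fun u t : borel G => charged w u * g u t)); last 2 first.
- by move=> u t; rewrite mule_ge0// charged_ge0.
- by apply: emeasurable_funM => //; exact: measurable_charged.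
rewrite [RHS](transfer w g0 mg); apply: eq_integral => u _.
have mgu : measurable_fun setT (g u) by exact: (measurable_fun_comp2 mg).
rewrite -[RHS]integral_uncharged// -ge0_integralZl ?charged_ge0//.
- by apply: eq_integral => t _; rewrite muleA.
- apply: emeasurable_funM => //; apply: measurable_indic_comp => //.
  exact: measurable_funB_borel.
- by move=> t _; rewrite mule_ge0// lee_fin.
Qed.

(** Under [lam (du) X (w, dt)] restricted to the pairs with [t] in [C + u], the
    point [t] is, given [u], a random point of the window, of law [T_C];
    it can therefore be replaced by another random point [s] of the same window. *)
Lemma transfer_TCker w (f : borel G -> borel G -> \bar R) :
  (forall u s, 0 <= f u s) -> measurable_fun setT (fun p => f p.1 p.2) ->
  \int[X w]_t \int[ell]_r
     (charged w (t - r)%R * \int[TCker (w, (t - r)%R)]_s f (t - r)%R s) =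
  \int[X w]_s \int[ell]_r f (s - r)%R s.
Proof.
move=> f0 mf; apply: (fin_muleI lamC_fin lamC0).
have mh : measurable_fun setT (fun u => \int[TCker (w, u)]_s f u s).
  apply: (measurable_integral_kernel TCker (f := fun u : borel G => (w, u))
    (g := f)) => //; exact: measurable_fun_pair.
have h0 u : 0 <= \int[TCker (w, u)]_s f u s by exact: integral_ge0.
pose g u (_ : borel G) := charged w u * \int[TCker (w, u)]_s f u s.
have g0 u t : 0 <= g u t by rewrite mule_ge0// charged_ge0.
have mg : measurable_fun setT (fun p : borel G * borel G => g p.1 p.2).
  apply: emeasurable_funM => //; first exact: measurable_charged.
  exact: (measurableT_comp mh).
transitivity (lam C * \int[X w]_t \int[ell]_r g (t - r)%R t); first by [].
rewrite (transfer w g0 mg).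
rewrite (transfer w f0 mf); apply: eq_integral => u _.
have mfu : measurable_fun setT (f u) by exact: (measurable_fun_comp2 mf).
rewrite -[RHS]integral_uncharged// -[in RHS]integral_TCker// /g.
rewrite ge0_integralZl//; last 2 first.
- by apply: measurable_indic_comp => //; exact: measurable_funB_borel.
- by rewrite mule_ge0// charged_ge0.
rewrite -muleA; congr (_ * _); rewrite muleC; congr (_ * _).
transitivity (\int[X w]_t (\1_[set (c + u)%R | c in C] t)%:E).
  by apply: eq_integral => t _; rewrite mem_translate.
by rewrite integral_indic ?setIT//; exact: measurable_translate.
Qed.

End transfer.
End conditioning_kernel.

(** * A preserving kernel that randomizes the position in a window *)

Section randomized_kernel.
Context d (Omega : measurableType d) (G : topologicalZmodType) (R : realType).
Hypothesis G2 : @second_countable G.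
Context (theta : borel G -> Omega -> Omega) (theta_flow : measurable_flow theta).
Context (X : R.-sfker Omega ~> borel G).
Hypothesis X_lf : forall w, locally_finite (X w).
Hypothesis X_inv : forall (w : Omega) (s : borel G) (B : set (borel G)),
  measurable B -> X (theta s w) [set b - s | b in B] = X w B.
Context (C : set (borel G)) (mC : measurable C) (pC : precompact C).
Context (P0 : probability (borel G) R).
Context (lam : {sigma_finite_measure set (borel G) -> \bar R}).
Hypothesis lam_inv : forall (t : borel G) (B : set (borel G)), measurable B ->
  lam [set (b + t)%R | b in B] = lam B.
Hypothesis lamC0 : lam C != 0%E.
Hypothesis lamC_lty : (lam C < +oo)%E.
Local Open Scope ereal_scope.
Let ell := mcond lam mC P0.
Let N : R.-sfker (Omega * borel G)%type ~> borel G := TCker G2 X mC P0.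
Local Notation charged := (charged X C).

Section kernel.
Context (B : set (borel G)) (mB : measurable B).
Let OG := (Omega * borel G)%type.

Lemma measurable_lag :
  measurable_fun setT (fun q : OG * borel G => (q.1.1, q.1.2 - q.2)%R).
Proof.
apply: measurable_fun_pair; first exact: measurableT_comp.
by apply: measurable_funB_borel => //; exact: measurableT_comp.
Qed.

Lemma measurable_site : measurable_fun setT (fun q : OG * borel G => q.1.2).
Proof. exact: measurableT_comp. Qed.

Definition move_set : set (OG * borel G * borel G) :=
  [set z | window_mass X C z.1.1.1 (z.1.1.2 - z.1.2)%R != 0] `&`
  [set z | B (z.2 - (z.1.1.2 - z.1.2))%R].

Definition stay_set : set (OG * borel G * borel G) :=
  [set z | window_mass X C z.1.1.1 (z.1.1.2 - z.1.2)%R != 0] `&`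
  [set z | ~ B z.1.2].

Lemma measurable_lag_charged : measurable
  [set z : OG * borel G * borel G |
     window_mass X C z.1.1.1 (z.1.1.2 - z.1.2)%R != 0].
Proof.
have mU := measurable_charged_set theta_flow X_inv mC.
have := measurableT_comp measurable_lag
  (@measurable_fst _ _ (OG * borel G)%type (borel G)).
by move=> /(_ measurableT _ mU); rewrite setTI.
Qed.

Lemma measurable_move_set : measurable move_set.
Proof.
apply: measurableI; first exact: measurable_lag_charged.
have : measurable_fun setT (fun z : OG * borel G * borel G =>
    z.2 - (z.1.1.2 - z.1.2))%R.
  apply: measurable_funB_borel => //; apply: measurable_funB_borel => //.
    by apply: (measurableT_comp measurable_site).
  exact: measurableT_comp.
by move=> /(_ measurableT _ mB); rewrite setTI.
Qed.

Lemma measurable_stay_set : measurable stay_set.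
Proof.
apply: measurableI; first exact: measurable_lag_charged.
have : measurable_fun setT (fun z : OG * borel G * borel G => z.1.2).
  exact: measurableT_comp.
by move=> /(_ measurableT _ (measurableC mB)); rewrite setTI.
Qed.

(** The window [C + t - r] is placed at random around the point [t]. Mass goes
    to a random point [s] of the window whose position [s - (t - r)] lies in [B],
    which is the integrand of mass-stationarity tested on [B]; and it stays at
    [t] if the position [r] of [t] does not lie in [B]. The two masses need not
    add up to one at a given [t]; only the proportions of [X] that they
    contribute are complementary. *)
Definition randomized_step : R.-sfker (OG * borel G)%type ~> borel G :=
  kadd (krestr measurable_move_set (kpull measurable_lag N))
       (krestr measurable_stay_set (kdirac measurable_site)).

Definition randomized_kernel : R.-sfker OG ~> borel G :=
  kcst ell \; randomized_step.

Lemma integral_randomized_step w t r (f : borel G -> \bar R) :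
  (forall s, 0 <= f s) -> measurable_fun setT f ->
  \int[randomized_step ((w, t), r)]_s f s =
  charged w (t - r)%R * \int[N (w, (t - r)%R)]_s (f s * (\1_B (s - (t - r))%R)%:E)
  + charged w (t - r)%R * (f t * (\1_(~` B) r)%:E).
Proof.
move=> f0 mf; rewrite ge0_integral_measure_add//; congr (_ + _).
  transitivity (\int[krestr measurable_move_set (kpull measurable_lag N)
    (w, t, r)]_s f s); first by [].
  rewrite integral_krestr//.
  transitivity (\int[N (w, (t - r)%R)]_s
      (charged w (t - r)%R * (f s * (\1_B (s - (t - r))%R)%:E))).
    apply: eq_integral => s _; rewrite muleCA; congr (_ * _).
    by rewrite /move_set indicI /=.
  rewrite ge0_integralZl//.
  - apply: emeasurable_funM => //; apply: measurable_indic_comp => //.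
    exact: measurable_funB_borel.
  - by move=> s _; rewrite mule_ge0// lee_fin.
  - by rewrite charged_ge0.
transitivity (\int[krestr measurable_stay_set (kdirac measurable_site)
  (w, t, r)]_s f s); first by [].
rewrite integral_krestr// integral_dirac//; last first.
  apply: emeasurable_funM => //; apply: measurable_indic_comp => //.
    exact: measurable_stay_set.
rewrite diracT mul1e muleCA; congr (_ * _).
by rewrite /stay_set indicI /=.
Qed.

Lemma integral_randomized_kernel w t (f : borel G -> \bar R) :
  (forall s, 0 <= f s) -> measurable_fun setT f ->
  \int[randomized_kernel (w, t)]_s f s = \int[ell]_r
    (charged w (t - r)%R *
       \int[N (w, (t - r)%R)]_s (f s * (\1_B (s - (t - r))%R)%:E) +
     charged w (t - r)%R * (f t * (\1_(~` B) r)%:E)).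
Proof.
move=> f0 mf.
transitivity (\int[kcomp (kcst ell) randomized_step (w, t)]_s f s); first by [].
rewrite integral_kcomp//; apply: eq_integral => r _.
exact: integral_randomized_step.
Qed.

Lemma randomized_kernel_bounded p : randomized_kernel p setT <= 2%:E.
Proof.
have N1 q : N q setT = 1.
  by rewrite /N /TCker /knormalize /= probability_setT.
apply: (@le_trans _ _ (\int[ell]_r (cst 2%:E) r)); last first.
  by rewrite integral_cst// [X in _ * X](_ : _ = 1) ?mule1//;
    exact: (@probability_setT _ _ _ ell).
rewrite [leLHS](_ : _ = \int[ell]_r randomized_step (p, r) setT)//.
apply: ge0_le_integral => //.
  exact: measurableT_comp (measurable_kernel randomized_step _ measurableT) _.
move=> r _; rewrite (_ : 2%:E = 1 + 1 :> \bar R); last by rewrite -EFinD.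
rewrite [leLHS](_ : _ = krestr measurable_move_set (kpull measurable_lag N)
  (p, r) setT + krestr measurable_stay_set (kdirac measurable_site) (p, r) setT).
  rewrite /krestr /= /mrestr !setTI; apply: leeD.
    rewrite -(N1 (p.1, p.2 - r)%R); apply: le_measure; rewrite ?inE//.
    exact: (measurable_xsection _ measurable_move_set).
  by rewrite /dirac /= lee_fin indicE; case: (_ \in _).
exact: measure_addE.
Qed.

(** By the two transfer principles the moves contribute the proportion
    [lam_C B] of [X], and the points that stay contribute the remaining
    proportion [lam_C (~` B)]. *)
Lemma randomized_kernel_preserving w (D : set (borel G)) : measurable D ->
  \int[X w]_t randomized_kernel (w, t) D = X w D.
Proof.
move=> mD.
pose iD s : \bar R := (\1_D s)%:E.
have d0 s : 0 <= iD s by rewrite lee_fin.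
have md : measurable_fun setT iD by exact/measurable_EFinP/measurable_indic.
pose f u s := iD s * (\1_B (s - u)%R)%:E.
pose g u s := iD s * (\1_(~` B) (s - u)%R)%:E.
have f0 u s : 0 <= f u s by rewrite mule_ge0// lee_fin.
have g0 u s : 0 <= g u s by rewrite mule_ge0// lee_fin.
have mf : measurable_fun setT (fun p : borel G * borel G => f p.1 p.2).
  apply: emeasurable_funM; first exact: measurableT_comp.
  by apply: measurable_indic_comp => //; exact: measurable_funB_borel.
have mg : measurable_fun setT (fun p : borel G * borel G => g p.1 p.2).
  apply: emeasurable_funM; first exact: measurableT_comp.
  apply: measurable_indic_comp; first exact: measurableC.
  exact: measurable_funB_borel.
have mlag : measurable_fun setT
    (fun p : borel G * borel G => p.1 - p.2)%R by exact: measurable_funB_borel.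
pose a t r := charged w (t - r)%R * \int[N (w, (t - r)%R)]_s f (t - r)%R s.
pose b t r := charged w (t - r)%R * g (t - r)%R t.
have a0 t r : 0 <= a t r by rewrite mule_ge0 ?charged_ge0// integral_ge0.
have b0 t r : 0 <= b t r by rewrite mule_ge0 ?charged_ge0.
have mch : measurable_fun setT
    (fun p : borel G * borel G => charged w (p.1 - p.2)%R).
  exact: (measurable_charged theta_flow X_inv mC).
have ma : measurable_fun setT (fun p : borel G * borel G => a p.1 p.2).
  apply: emeasurable_funM => //.
  apply: (measurable_integral_kernel N
    (f := fun p : borel G * borel G => (w, (p.1 - p.2)%R))
    (g := fun p s => f (p.1 - p.2)%R s)) => //.
    exact: measurable_fun_pair.
  by apply: (measurable_fun_comp2 mf) => //; exact: (measurableT_comp mlag).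
have mb : measurable_fun setT (fun p : borel G * borel G => b p.1 p.2).
  by apply: emeasurable_funM => //; exact: (measurable_fun_comp2 mg).
have ma' : measurable_fun setT (fun t => \int[ell]_r a t r).
  exact: (measurable_integral_sfinite ell).
have mb' : measurable_fun setT (fun t => \int[ell]_r b t r).
  exact: (measurable_integral_sfinite ell).
transitivity (\int[X w]_t (\int[ell]_r a t r + \int[ell]_r b t r)).
  apply: eq_integral => t _.
  transitivity (\int[randomized_kernel (w, t)]_s iD s).
    by rewrite integral_indic// setIT.
  rewrite integral_randomized_kernel// -ge0_integralD//; last 2 first.
  - exact: (measurable_fun_comp2 ma).
  - exact: (measurable_fun_comp2 mb).
  by apply: eq_integral => r _; rewrite /b /g subKr.
rewrite ge0_integralD//; last 2 first.
- by move=> t _; exact: integral_ge0.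
- by move=> t _; exact: integral_ge0.
rewrite /a (transfer_TCker G2 theta_flow X_lf X_inv mC pC P0 lam_inv lamC0
  lamC_lty w f0 mf).
rewrite /b (transfer_charged G2 theta_flow X_lf X_inv mC pC P0 lam_inv lamC0
  lamC_lty w g0 mg).
have cE (E : set (borel G)) t : measurable E ->
    \int[ell]_r (iD t * (\1_E (t - (t - r))%R)%:E) = iD t * ell E.
  move=> mE; under eq_integral do rewrite subKr.
  rewrite ge0_integralZl//.
  - by rewrite integral_indic// setIT.
  - exact/measurable_EFinP/measurable_indic.
rewrite (eq_integral (fun t => iD t * ell B)); last by move=> t _; exact: cE.
rewrite [X in _ + X](eq_integral (fun t => iD t * ell (~` B))); last first.
  by move=> t _; apply: cE; exact: measurableC.
rewrite -ge0_integralD//; last 4 first.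
- by move=> t _; rewrite mule_ge0.
- exact: emeasurable_funM.
- by move=> t _; rewrite mule_ge0.
- exact: emeasurable_funM.
transitivity (\int[X w]_t iD t); last by rewrite integral_indic// setIT.
apply: eq_integral => t _; rewrite -ge0_muleDr// -measureU//; last 2 first.
- exact: measurableC.
- by rewrite setICr.
rewrite setUv [X in _ * X](_ : _ = 1) ?mule1//.
exact: (@probability_setT _ _ _ ell).
Qed.

(** Shifting [w] and the window together shifts the conditional law, except on
    windows without mass, where [T_C] is a fixed measure. *)
Lemma TCker_theta w u v (f : borel G -> \bar R) :
  (forall s, 0 <= f s) -> measurable_fun setT f ->
  charged w v * \int[N (theta u w, (v - u)%R)]_s f s =
  charged w v * \int[N (w, v)]_s f (s - u)%R.
Proof.
move=> f0 mf; rewrite chargedE; case: eqVneq => [_|v0]; first by rewrite !mul0e.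
rewrite !mul1e.
have wfin : window_mass X C w v \is a fin_num.
  by rewrite ge0_fin_numE ?measure_ge0//; exact: (window_mass_lty X_lf X_inv mC pC).
apply: (fin_muleI wfin v0).
have mfu : measurable_fun setT (fun s : borel G => f (s - u)%R).
  by apply: measurableT_comp mf _; exact: measurable_funB_borel.
rewrite [RHS](integral_TCker G2 X_lf X_inv mC pC)//.
rewrite -(window_mass_theta theta_flow X_inv mC w u v).
rewrite (integral_TCker G2 X_lf X_inv mC pC)//.
rewrite (integral_theta G2 X_inv)//.
- by apply: eq_integral => s _; rewrite opprB addrA subrK.
- apply: emeasurable_funM => //; apply: measurable_indic_comp => //.
  exact: measurable_funB_borel.
- by move=> s; rewrite mule_ge0// lee_fin.
Qed.

Lemma randomized_kernel_invariant s t w (D : set (borel G)) : measurable D ->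
  randomized_kernel (theta t w, (s - t)%R) [set (b - t)%R | b in D] =
  randomized_kernel (w, s) D.
Proof.
move=> mD; have mDt : measurable [set (b - t)%R | b in D].
  exact: measurable_translate.
have DtE x : \1_[set (b - t)%R | b in D] x = \1_D (x + t)%R :> R.
  by rewrite mem_translate opprK.
transitivity (\int[randomized_kernel (theta t w, (s - t)%R)]_x
  (\1_[set (b - t)%R | b in D] x)%:E).
  by rewrite integral_indic// setIT.
transitivity (\int[randomized_kernel (w, s)]_x (\1_D x)%:E); last first.
  by rewrite integral_indic// setIT.
have m1 (E : set (borel G)) : measurable E ->
    measurable_fun setT (fun x => (\1_E x)%:E : \bar R).
  by move=> mE; exact/measurable_EFinP/measurable_indic.
rewrite !integral_randomized_kernel//; [|exact: m1|exact: m1].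
apply: eq_integral => r _; rewrite (addrAC s (- t)%R (- r)%R).
have -> : charged (theta t w) (s - r - t)%R = charged w (s - r)%R.
  by rewrite !chargedE (window_mass_theta theta_flow X_inv mC).
congr (_ + _); last by rewrite DtE subrK.
rewrite TCker_theta.
- congr (_ * _); apply: eq_integral => x _.
  by rewrite DtE subrK opprB addrA subrK.
- by move=> x; rewrite mule_ge0// lee_fin.
- apply: emeasurable_funM; first exact: m1.
  by apply: measurable_indic_comp => //; exact: measurable_funB_borel.
Qed.

End kernel.
End randomized_kernel.

(** * Invariance under preserving kernels implies mass-stationarity *)

Section mass_law.
Context d (Omega : measurableType d) (G : topologicalZmodType) (R : realType).
Hypothesis G2 : @second_countable G.
Context (theta : borel G -> Omega -> Omega) (theta_flow : measurable_flow theta).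
Context (X : R.-sfker Omega ~> borel G).
Context (C : set (borel G)) (mC : measurable C).
Context (P0 : probability (borel G) R).
Context (lam : {sigma_finite_measure set (borel G) -> \bar R}).
Context (Q : {sigma_finite_measure set Omega -> \bar R}).
Local Open Scope ereal_scope.
Let ell := mcond lam mC P0.
Let N : R.-sfker (Omega * borel G)%type ~> borel G := TCker G2 X mC P0.

Let m_site : measurable_fun setT
  (fun q : unit * Omega * borel G => (q.1.2, - q.2)%R).
Proof.
apply: measurable_fun_pair; first exact: measurableT_comp.
exact: measurable_funN_borel.
Qed.

Let m_shift : measurable_fun setT
  (fun z : unit * Omega * borel G * borel G =>
     (theta z.2 z.1.1.2, z.2 + z.1.2)%R).
Proof.
apply: measurable_fun_pair.
  apply: measurable_theta => //.
  by apply: measurableT_comp => //; apply: measurableT_comp.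
by apply: measurable_funD_borel => //; exact: measurableT_comp.
Qed.

(** The left-hand side of the definition of mass-stationarity, as a measure on
    [Omega * G]. *)
Definition mass_law : {measure set (Omega * borel G) -> \bar R} :=
  (kcst Q \; (kcst ell \; (kpull m_site N \; kdirac m_shift))) tt.

Lemma integral_mass_law (h : Omega -> borel G -> \bar R) :
  (forall w r, 0 <= h w r) ->
  measurable_fun setT (fun p : Omega * borel G => h p.1 p.2) ->
  \int[mass_law]_p h p.1 p.2 =
  \int[Q]_w \int[ell]_r \int[N (w, (- r)%R)]_s h (theta s w) (s + r)%R.
Proof.
move=> h0 mh; have h0' (p : Omega * borel G) : 0 <= h p.1 p.2 by [].
transitivity (\int[kcomp (kcst Q)
  (kcst ell \; (kpull m_site N \; kdirac m_shift))%E tt]_p h p.1 p.2);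
  first by [].
rewrite integral_kcomp//; apply: eq_integral => w _.
transitivity (\int[kcomp (kcst ell)
  (kpull m_site N \; kdirac m_shift)%E (tt, w)]_p h p.1 p.2); first by [].
rewrite integral_kcomp//; apply: eq_integral => r _.
transitivity (\int[kcomp (kpull m_site N) (kdirac m_shift) (tt, w, r)]_p
  h p.1 p.2); first by [].
rewrite integral_kcomp//; apply: eq_integral => s _.
by rewrite integral_dirac// diracT mul1e.
Qed.

Lemma mass_lawE (A : set (Omega * borel G)) : measurable A ->
  mass_law A = \int[Q]_w \int[ell]_r \int[N (w, (- r)%R)]_s
    (\1_A (theta s w, (s + r)%R))%:E.
Proof.
move=> mA; rewrite -(integral_mass_law (h := fun w r => (\1_A (w, r))%:E)).
- rewrite -[in LHS](setIT A) -integral_indic//.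
  by apply: eq_integral => -[].
- by move=> w r; rewrite lee_fin.
- by apply: measurable_indic_comp => //; exact: measurable_fun_pair.
Qed.

End mass_law.

Section invariance_mass_stationary.
Context d (Omega : measurableType d) (G : topologicalZmodType) (R : realType).
Hypotheses (G_hausdorff : hausdorff_space G) (G2 : @second_countable G).
Context (theta : borel G -> Omega -> Omega) (theta_flow : measurable_flow theta).
Context (X : R.-sfker Omega ~> borel G).
Hypothesis X_lf : forall w, locally_finite (X w).
Hypothesis X_inv : forall (w : Omega) (s : borel G) (B : set (borel G)),
  measurable B -> X (theta s w) [set b - s | b in B] = X w B.
Context (C : set (borel G)) (mC : measurable C) (pC : precompact C).
Context (P0 : probability (borel G) R).
Context (lam : {sigma_finite_measure set (borel G) -> \bar R}).
Hypothesis lam_inv : forall (t : borel G) (B : set (borel G)), measurable B ->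
  lam [set (b + t)%R | b in B] = lam B.
Hypothesis lamC0 : lam C != 0%E.
Hypothesis lamC_lty : (lam C < +oo)%E.
Context (Q : {sigma_finite_measure set Omega -> \bar R}).
Local Open Scope ereal_scope.
Let ell := mcond lam mC P0.
Let N : R.-sfker (Omega * borel G)%type ~> borel G := TCker G2 X mC P0.
Local Notation charged := (charged X C).

Hypothesis Q_invariant : forall T : R.-ker (Omega * borel G)%type ~> borel G,
  weighted_transport_kernel T -> bounded_kernel T ->
  (forall (w : Omega) (B : set (borel G)), measurable B ->
     \int[X w]_s T (w, s) B = X w B) ->
  invariant_kernel theta T -> invariant_under theta Q T.

Let m_charged : measurable_fun setT
  (fun p : Omega * borel G => charged p.1 (- p.2)%R).
Proof.
by apply: (measurable_charged theta_flow X_inv mC) => //;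
  exact: measurable_funN_borel.
Qed.

(** Invariance of [Q] under the randomized kernel, tested on [A]: the first
    term is the law in the definition of mass-stationarity on [A `*` B], the
    second one is [Q A] times [lam_C (~` B)], apart from the windows without
    mass. *)
Lemma randomized_kernel_invariance (A : set Omega) (B : set (borel G)) :
  measurable A -> measurable B ->
  \int[Q]_w \int[ell]_r (charged w (- r)%R *
     \int[N (w, (- r)%R)]_s ((\1_A (theta s w))%:E * (\1_B (s + r)%R)%:E)) +
  \int[Q]_w \int[ell]_r (charged w (- r)%R * ((\1_A w)%:E * (\1_(~` B) r)%:E))
  = Q A.
Proof.
move=> mA mB.
have mind (E : set (borel G)) : measurable E ->
    measurable_fun setT (fun x => (\1_E x)%:E : \bar R).
  by move=> mE; exact/measurable_EFinP/measurable_indic.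
pose T := randomized_kernel G2 theta_flow X_inv mC P0 lam mB.
have T2 p : T p setT <= 2%:E by exact: randomized_kernel_bounded.
have Tb : bounded_kernel T.
  apply: (@le_lt_trans _ _ 2%:E); last exact: ltry.
  by apply: ge_ereal_sup => _ [p _ <-]; exact: T2.
have Twt : weighted_transport_kernel T.
  move=> p K cK; apply: (@le_lt_trans _ _ 2%:E); last exact: ltry.
  apply: le_trans (T2 p); apply: le_measure; rewrite ?inE//.
  by apply: borel_closed; exact: compact_closed.
have Tp : forall (w : Omega) (D : set (borel G)), measurable D ->
    \int[X w]_s T (w, s) D = X w D.
  move=> w D mD; exact: (randomized_kernel_preserving G2 theta_flow X_lf X_inv
    mC pC P0 lam_inv lamC0 lamC_lty).
have Ti : invariant_kernel theta T.
  move=> s t w D mD; exact: (randomized_kernel_invariant G2 theta_flow X_lf X_inv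
    mC pC P0 lam).
have /= := Q_invariant Twt Tb Tp Ti (f := \1_A).
rewrite integral_indic// setIT => <-//.
have mf (w : Omega) : measurable_fun setT
    (fun s : borel G => (\1_A (theta s w))%:E : \bar R).
  by apply: measurable_indic_comp => //; exact: measurable_theta.
rewrite -ge0_integralD//; last 4 first.
- move=> w _; apply: integral_ge0 => r _.
  by rewrite mule_ge0 ?charged_ge0// integral_ge0// => s _; rewrite mule_ge0// lee_fin.
- apply: (measurable_integral_sfinite ell (g := fun w r => charged w (- r)%R *
     \int[N (w, (- r)%R)]_s ((\1_A (theta s w))%:E * (\1_B (s + r)%R)%:E))).
    move=> w r.
    by rewrite mule_ge0 ?charged_ge0// integral_ge0// => s _; rewrite mule_ge0// lee_fin.
  apply: emeasurable_funM => //.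
  apply: (measurable_integral_kernel N
    (f := fun p : Omega * borel G => (p.1, - p.2)%R)
    (g := fun (p : Omega * borel G) s =>
       (\1_A (theta s p.1))%:E * (\1_B (s + p.2)%R)%:E)).
  + by apply: measurable_fun_pair => //; exact: measurable_funN_borel.
  + by move=> p s; rewrite mule_ge0// lee_fin.
  + apply: emeasurable_funM; apply: measurable_indic_comp => //.
      by apply: measurable_theta => //; exact: measurableT_comp.
    by apply: measurable_funD_borel => //; exact: measurableT_comp.
- move=> w _; apply: integral_ge0 => r _.
  by rewrite mule_ge0 ?charged_ge0// mule_ge0// lee_fin.
- apply: (measurable_integral_sfinite ell (g := fun w r => charged w (- r)%R *
     ((\1_A w)%:E * (\1_(~` B) r)%:E))).
    by move=> w r; rewrite mule_ge0 ?charged_ge0// mule_ge0// lee_fin.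
  apply: emeasurable_funM => //.
  by apply: emeasurable_funM; apply: measurable_indic_comp => //;
    exact: measurableC.
apply: eq_integral => w _.
rewrite (integral_randomized_kernel G2 theta_flow X_inv mC P0 lam mB w 0%R
  (f := fun s => (\1_A (theta s w))%:E))//.
rewrite -ge0_integralD//; last 4 first.
- move=> r _.
  by rewrite mule_ge0 ?charged_ge0// integral_ge0// => s _; rewrite mule_ge0// lee_fin.
- apply: emeasurable_funM.
    apply: (measurable_charged theta_flow X_inv mC) => //.
    exact: measurable_funN_borel.
  apply: (measurable_integral_kernel N (f := fun r : borel G => (w, - r)%R)
    (g := fun r s => (\1_A (theta s w))%:E * (\1_B (s + r)%R)%:E)).
  + by apply: measurable_fun_pair => //; exact: measurable_funN_borel.
  + by move=> p s; rewrite mule_ge0// lee_fin.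
  + apply: emeasurable_funM; apply: measurable_indic_comp => //.
      by apply: measurable_theta => //; exact: measurableT_comp.
    by apply: measurable_funD_borel => //; exact: measurableT_comp.
- by move=> r _; rewrite mule_ge0 ?charged_ge0// mule_ge0// lee_fin.
- apply: emeasurable_funM.
    apply: (measurable_charged theta_flow X_inv mC) => //.
    exact: measurable_funN_borel.
  by apply: measurable_funeM; apply: mind; exact: measurableC.
apply: eq_integral => r _; rewrite sub0r (theta0 theta_flow).
by under [in RHS]eq_integral do rewrite opprK.
Qed.

(** The kernel for [B = set0] only keeps the points at which the window is
    charged; invariance then says that they carry all of [Q]. *)
Lemma uncharged_null :
  (Q \x ell) [set p | window_mass X C p.1 (- p.2)%R = 0] = 0.
Proof.
set U := mkset _.
have UE : U = ~` [set p | window_mass X C p.1 (- p.2)%R != 0].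
  apply/seteqP; split => p; rewrite /U /=; first by move=> ->; rewrite eqxx.
  by move=> /negP/negPn/eqP.
have mV : measurable [set p : Omega * borel G | window_mass X C p.1 (- p.2)%R != 0].
  have mU := measurable_charged_set theta_flow X_inv mC.
  have : measurable_fun setT (fun p : Omega * borel G => (p.1, - p.2)%R).
    by apply: measurable_fun_pair => //; exact: measurable_funN_borel.
  by move=> /(_ measurableT _ mU); rewrite setTI.
have mU : measurable U by rewrite UE; exact: measurableC.
have ellT : ell setT = 1 by exact: (@probability_setT _ _ _ ell).
have [E cE EQ] := sigma_finiteT Q.
have mE n : measurable (E n) by have [] := EQ n.
have Eoo n : Q (E n) < +oo by have [] := EQ n.
have mET n : measurable (E n `*` [set: borel G]) by exact: measurableX.
have null n : (Q \x ell) ((E n `*` setT) `&` U) = 0.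
  have h : (Q \x ell) ((E n `*` setT) `&` ~` U) = Q (E n).
    rewrite -[RHS](randomized_kernel_invariance (mE n) (@measurable0 _ (borel G))).
    rewrite [X in _ = X + _](_ : _ = 0) ?add0e; last first.
      apply: integral0_eq => w _; apply: integral0_eq => r _.
      rewrite integral0_eq ?mule0// => s _.
      by rewrite indic0 mule0.
    have mEU : measurable ((E n `*` setT) `&` ~` U).
      by apply: measurableI => //; exact: measurableC.
    transitivity (\int[Q]_w ell (xsection ((E n `*` setT) `&` ~` U) w)).
      by [].
    apply: eq_integral => w _.
    transitivity (\int[ell]_r
        (\1_(xsection ((E n `*` setT) `&` ~` U) w) r)%:E).
      by rewrite integral_indicT//; exact: measurable_xsection.
    apply: eq_integral => r _.
    rewrite setC0 indicT mule1 -EFinM indicE mem_xsection -indicE UE setCK.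
    by rewrite indicI /= indicX indicT mulr1 mulrC.
  have fin : Q (E n) \is a fin_num by rewrite ge0_fin_numE.
  have ET : (Q \x ell) (E n `*` setT) = Q (E n).
    by rewrite product_measure1E// [X in _ * X](_ : _ = 1) ?mule1.
  have := measureDI (Q \x ell) (mET n) mU.
  rewrite setDE [X in X = _](_ : _ = Q (E n)); last exact: ET.
  rewrite [X in _ = X + _](_ : _ = Q (E n)); last exact: h.
  move=> /(congr1 (fun z => z - Q (E n))).
  by rewrite subee// addeAC subee// add0e => <-.
have cU : U = \bigcup_n ((E n `*` setT) `&` U).
  by rewrite -setI_bigcupl -setX_bigcupl -cE setXTT setTI.
apply/eqP; rewrite -measure_le0.
apply: (@le_trans _ _ (\sum_(n <oo) (Q \x ell)%E ((E n `*` setT) `&` U))).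
  apply: measure_sigma_subadditive => //.
  - by move=> n; exact: measurableI.
  - by rewrite -cU.
by rewrite eseries0.
Qed.

Lemma charged_drop (h : Omega -> borel G -> \bar R) :
  (forall w r, 0 <= h w r) ->
  measurable_fun setT (fun p : Omega * borel G => h p.1 p.2) ->
  \int[Q]_w \int[ell]_r (charged w (- r)%R * h w r) =
  \int[Q]_w \int[ell]_r h w r.
Proof.
move=> h0 mh.
rewrite -(fubini_tonelli1 (m1 := Q) (m2 := ell) (fun p => h p.1 p.2))//.
rewrite -(fubini_tonelli1 (m1 := Q) (m2 := ell)
  (fun p => charged p.1 (- p.2)%R * h p.1 p.2)); last 2 first.
- exact: emeasurable_funM.
- by move=> p; rewrite mule_ge0// charged_ge0.
have mU : measurable [set p : Omega * borel G | window_mass X C p.1 (- p.2)%R = 0].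
  rewrite (_ : mkset _ = (fun p => charged p.1 (- p.2)%R) @^-1` [set 0]).
    by rewrite -[X in measurable X]setTI; apply: m_charged => //.
  apply/seteqP; split => p /=; rewrite chargedE.
    by move=> ->; rewrite eqxx.
  by case: eqVneq => // _ /eqP; rewrite onee_eq0.
apply: (ge0_integral_eq_off_null mU uncharged_null) => //.
- exact: emeasurable_funM.
- by move=> p; rewrite mule_ge0// charged_ge0.
- by move=> p /= /eqP/negbTE p0; rewrite chargedE p0 mul1e.
Qed.

(** The part of the randomized kernel that does not move accounts for
    [Q A * lam_C (~` B)] of [Q A], so the part that moves must account for
    [Q A * lam_C B]. *)
Lemma invariance_mass_law (A : set (Omega * borel G)) : measurable A ->
  mass_law G2 theta_flow X mC P0 lam Q A = (Q \x ell) A.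
Proof.
have ellT : ell setT = 1 by exact: (@probability_setT _ _ _ ell).
have [E cE EQ] := sigma_finiteT Q.
have mE n : measurable (E n) by have [] := EQ n.
have Eoo n : Q (E n) < +oo by have [] := EQ n.
move=> mA; apply/esym; move: A mA.
apply: (measure_eq_prod (E := E) (F := fun _ => setT)) => //.
- by rewrite -setX_bigcupl -cE setXTT.
- move=> n; apply: le_lt_trans (Eoo n).
  by rewrite -[leRHS]mule1 -ellT -(product_measure1E Q ell (mE n) measurableT).
move=> n A B mA mB AE _; transitivity (Q A * ell B).
  exact: product_measure1E.
have QA : Q A \is a fin_num.
  by rewrite ge0_fin_numE//; apply: le_lt_trans (Eoo n); apply: le_measure;
    rewrite ?inE.
rewrite mass_lawE; last exact: measurableX.
have mAB (S : set (borel G)) : measurable S -> measurable_fun setT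
    (fun p : Omega * borel G => (\1_A p.1)%:E * (\1_S p.2)%:E : \bar R).
  by move=> mS; apply: emeasurable_funM; apply: measurable_indic_comp.
have AB0 (S : set (borel G)) w r : 0 <= (\1_A w)%:E * (\1_S r)%:E :> \bar R.
  by rewrite mule_ge0// lee_fin.
have := randomized_kernel_invariance mA mB.
rewrite (charged_drop (h := fun w r => \int[N (w, (- r)%R)]_s
  ((\1_A (theta s w))%:E * (\1_B (s + r)%R)%:E))); last 2 first.
- by move=> w r; apply: integral_ge0 => s _.
- apply: (measurable_integral_kernel N
    (f := fun p : Omega * borel G => (p.1, - p.2)%R)
    (g := fun (p : Omega * borel G) s =>
       (\1_A (theta s p.1))%:E * (\1_B (s + p.2)%R)%:E)) => //.
  + by apply: measurable_fun_pair => //; exact: measurable_funN_borel.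
  + apply: emeasurable_funM; apply: measurable_indic_comp => //.
      by apply: measurable_theta => //; exact: measurableT_comp.
    by apply: measurable_funD_borel => //; exact: measurableT_comp.
rewrite (charged_drop (h := fun w r => (\1_A w)%:E * (\1_(~` B) r)%:E)); last 2 first.
- by move=> w r; exact: AB0.
- by apply: mAB; exact: measurableC.
have -> : \int[Q]_w \int[ell]_r ((\1_A w)%:E * (\1_(~` B) r)%:E) =
    Q A * ell (~` B).
  have mB' : measurable_fun setT (fun r => (\1_(~` B) r)%:E : \bar R).
    exact/measurable_EFinP/measurable_indic/measurableC.
  transitivity (\int[Q]_w ((\1_A w)%:E * ell (~` B))).
    apply: eq_integral => w _; rewrite ge0_integralZl//.
    by rewrite integral_indicT//; exact: measurableC.
  rewrite ge0_integralZr ?integral_indicT//.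
  exact/measurable_EFinP/measurable_indic.
set a := (X in X + _) => aE.
have fB : Q A * ell (~` B) \is a fin_num.
  by rewrite fin_numM// fin_num_measure//; exact: measurableC.
have : Q A = Q A * ell B + Q A * ell (~` B).
  rewrite -ge0_muleDr// (_ : _ + _ = 1) ?mule1//.
  rewrite -ellT -(setUv B); apply/esym/measureU => //; last by rewrite setICr.
  exact: measurableC.
rewrite -{1}aE => /(congr1 (fun z => z - Q A * ell (~` B))).
rewrite (addeK _ fB) (addeK _ fB) => <-; rewrite /a.
apply: eq_integral => w _; apply: eq_integral => r _; apply: eq_integral => s _.
by rewrite indicX EFinM.
Qed.

End invariance_mass_stationary.

(** * Mass-stationarity implies the Mecke equation *)

(** Dynkin's lemma for the second coordinate: [D] enters through the finite
    measure [D |-> m1 (S `*` (D `&` K))], and likewise for [m2]. *)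
Lemma measure_eq_setX d1 d2 (T1 : measurableType d1) (T2 : measurableType d2)
    (R : realType) (m1 m2 : {measure set (T1 * T2) -> \bar R})
    (H : set (set T2)) (g : (set T2)^nat) (S : set T1) (K : set T2) :
  measurable = <<s H >> -> setI_closed H -> (forall n, H (g n)) ->
  \bigcup_n g n = setT -> measurable S -> measurable K ->
  (m1 (S `*` K) < +oo)%E ->
  (forall D, H D -> m1 (S `*` (D `&` K)) = m2 (S `*` (D `&` K))) ->
  forall D, measurable D -> D `<=` K -> m1 (S `*` D) = m2 (S `*` D).
Proof.
move=> HE HI Hg cg mS mK fin m12 D mD DK.
have mSK : measurable (S `*` K) by exact: measurableX.
have msnd : measurable_fun setT (@snd T1 T2) by exact: measurable_snd.
pose nu (m : {measure set (T1 * T2) -> \bar R}) : {measure set T2 -> \bar R} :=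
  measure_function_pushforward__canonical__measure_function_Measure
    (mrestr m mSK) msnd.
have nuE m E : nu m E = m (S `*` (E `&` K)).
  rewrite /nu /= /pushforward /mrestr; congr (m _).
  by apply/seteqP; split => [[x y] [/= Ey [Sx Ky]]|[x y] [/= Sx [Ey Ky]]].
rewrite -(setIidl DK) -!nuE.
apply: (measure_unique H g) => //.
- by move=> E HE'; rewrite !nuE m12.
- move=> n; rewrite nuE; apply: le_lt_trans fin; apply: le_measure.
  + rewrite inE; apply: measurableX => //; apply: measurableI => //.
    by rewrite HE; apply: sub_sigma_algebra.
  + by rewrite inE.
  + by move=> [x y] [/= Sx [_ Ky]].
Qed.

Section transport_law.
Context d d' (Omega : measurableType d) (T : measurableType d')
  (G : topologicalZmodType) (R : realType).
Context (X : R.-sfker Omega ~> borel G).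
Context (lam : {sigma_finite_measure set (borel G) -> \bar R}).
Context (Q : {sigma_finite_measure set Omega -> \bar R}).
Context (F : Omega -> borel G -> borel G -> T).
Local Open Scope ereal_scope.
Hypothesis mF : measurable_fun setT
  (fun z : unit * Omega * borel G * borel G => F z.1.1.2 z.1.2 z.2).

(** The law of [F w s r] under [Q (dw) X (w, ds) lam (dr)]. *)
Definition transport_law : {measure set T -> \bar R} :=
  (kcst Q \; (kpull (@measurable_snd _ _ unit Omega) X \;
     (kcst lam \; kdirac mF))) tt.

Lemma integral_transport_law (h : T -> \bar R) : (forall x, 0 <= h x) ->
  measurable_fun setT h ->
  \int[transport_law]_x h x = \int[Q]_w \int[X w]_s \int[lam]_r h (F w s r).
Proof.
move=> h0 mh.
transitivity (\int[kcomp (kcst Q) (kpull (@measurable_snd _ _ unit Omega) X \;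
     (kcst lam \; kdirac mF))%E tt]_x h x); first by [].
rewrite integral_kcomp//; apply: eq_integral => w _.
transitivity (\int[kcomp (kpull (@measurable_snd _ _ unit Omega) X)
  (kcst lam \; kdirac mF)%E (tt, w)]_x h x); first by [].
rewrite integral_kcomp//; apply: eq_integral => s _.
transitivity (\int[kcomp (kcst lam) (kdirac mF) (tt, w, s)]_x h x); first by [].
rewrite integral_kcomp//; apply: eq_integral => r _.
by rewrite integral_dirac// diracT mul1e.
Qed.

Lemma transport_lawE (A : set T) : measurable A ->
  transport_law A = \int[Q]_w \int[X w]_s \int[lam]_r (\1_A (F w s r))%:E.
Proof.
move=> mA; rewrite -(integral_transport_law (h := fun x => (\1_A x)%:E)).
- by rewrite integral_indicT.
- by move=> x; rewrite lee_fin.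
- exact/measurable_EFinP/measurable_indic.
Qed.

End transport_law.

Section mass_stationary_window.
Context d (Omega : measurableType d) (G : topologicalZmodType) (R : realType).
Hypothesis G2 : @second_countable G.
Context (theta : borel G -> Omega -> Omega) (theta_flow : measurable_flow theta).
Context (X : R.-sfker Omega ~> borel G).
Hypothesis X_lf : forall w, locally_finite (X w).
Hypothesis X_inv : forall (w : Omega) (s : borel G) (B : set (borel G)),
  measurable B -> X (theta s w) [set b - s | b in B] = X w B.
Context (P0 : probability (borel G) R).
Context (lam : {sigma_finite_measure set (borel G) -> \bar R}).
Hypothesis lam_inv : forall (t : borel G) (B : set (borel G)), measurable B ->
  lam [set (b + t)%R | b in B] = lam B.
Hypothesis lam_lf : locally_finite lam.
Context (Q : {sigma_finite_measure set Omega -> \bar R}).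
Local Open Scope ereal_scope.
Let N C (mC : measurable C) : R.-sfker (Omega * borel G)%type ~> borel G :=
  TCker G2 X mC P0.

Hypothesis Q_mass_stationary : forall (C : set (borel G)) (mC : measurable C),
  precompact C -> 0 < lam C -> lam (boundary C) = 0 ->
  forall A : set (Omega * borel G), measurable A ->
    mass_law G2 theta_flow X mC P0 lam Q A = (Q \x mcond lam mC P0) A.

Lemma mass_stationary_integral (C : set (borel G)) (mC : measurable C)
    (h : Omega -> borel G -> \bar R) :
  precompact C -> 0 < lam C -> lam (boundary C) = 0 ->
  (forall w r, 0 <= h w r) ->
  measurable_fun setT (fun p : Omega * borel G => h p.1 p.2) ->
  \int[Q]_w \int[mcond lam mC P0]_r \int[N mC (w, (- r)%R)]_s
     h (theta s w) (s + r)%R =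
  \int[Q]_w \int[mcond lam mC P0]_r h w r.
Proof.
move=> pC C0 bC h0 mh; have h0' (p : Omega * borel G) : 0 <= h p.1 p.2 by [].
have := fubini_tonelli1 (m1 := Q) (m2 := mcond lam mC P0) _ mh h0'.
rewrite /fubini_F /= => <-.
rewrite -(integral_mass_law G2 theta_flow X mC P0 lam Q h0 mh).
by apply: eq_measure_integral => A mA _; exact: Q_mass_stationary.
Qed.

(** Weighting the equation of mass-stationarity by the mass of the window
    removes the normalization; the window in the integrals on both sides then
    has become a condition on the pair [(r, s + r)], respectively [(r, r - s)]. *)
Lemma mass_stationary_window (C : set (borel G)) (k : Omega -> borel G -> \bar R) :
  continuity_set lam C ->
  (forall w r, 0 <= k w r) ->
  measurable_fun setT (fun p : Omega * borel G => k p.1 p.2) ->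
  \int[Q]_w \int[X w]_s \int[lam]_r
    (k w r * (\1_C r)%:E * (\1_C (s + r)%R)%:E) =
  \int[Q]_w \int[X w]_s \int[lam]_r
    (k (theta s w) r * (\1_C r)%:E * (\1_C (r - s)%R)%:E).
Proof.
move=> [mC pC bC] k0 mk.
have Coo := precompact_lty lam_lf mC pC.
have mI d' (T' : measurableType d') (f : T' -> borel G) :
    measurable_fun setT f ->
    measurable_fun setT (fun x => (\1_C (f x))%:E : \bar R).
  exact: measurable_indic_comp.
have mk1 w : measurable_fun setT (k w) by exact: (measurable_fun_comp2 mk).
have [C0|C0] := eqVneq (lam C) 0.
  have null (f g : borel G -> \bar R) : (forall r, 0 <= f r) ->
      (forall r, 0 <= g r) -> measurable_fun setT f -> measurable_fun setT g ->
      \int[lam]_r (f r * (\1_C r)%:E * g r) = 0.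
    move=> f0 g0 mf mg.
    under eq_integral do rewrite -muleA (muleC (\1_C _)%:E) muleA.
    rewrite -integral_indicM null_set_integral//.
    by apply: measurable_funTS; exact: emeasurable_funM.
  transitivity (0 : \bar R); last apply/esym; apply: integral0_eq => w _;
    apply: integral0_eq => s _; apply: null => //;
    apply: measurable_indic_comp => //.
  - exact: measurable_funD_borel.
  - exact: measurable_funB_borel.
have C0' : 0 < lam C by rewrite lt0e C0 measure_ge0.
have swap w (f : borel G -> borel G -> \bar R) : (forall s r, 0 <= f s r) ->
    measurable_fun setT (fun p : borel G * borel G => f p.1 p.2) ->
    \int[X w]_s \int[lam]_r (f s r * (\1_C r)%:E) =
    lam C * \int[mcond lam mC P0]_r \int[X w]_s f s r.
  move=> f0 mf.
  have mf' : measurable_fun setT (fun r => \int[X w]_s f s r).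
    apply: (measurable_integral_kernel X (f := fun _ : borel G => w)
      (g := fun r s => f s r)) => //.
    exact: (measurable_fun_comp2 mf).
  rewrite integral_mcond//; last by move=> r; exact: integral_ge0.
  rewrite (sfinite_cst_Fubini X lam w (f := fun s r => f s r * (\1_C r)%:E)).
  - apply: eq_integral => r _; rewrite ge0_integralZr ?lee_fin//.
    exact: (measurable_fun_comp2 mf).
  - by move=> s r; rewrite mule_ge0// lee_fin.
  - by apply: emeasurable_funM => //; exact: mI.
pose h w r := window_mass X C w (- r)%R * k w r.
have h0 w r : 0 <= h w r by rewrite mule_ge0// measure_ge0.
have mh : measurable_fun setT (fun p : Omega * borel G => h p.1 p.2).
  apply: emeasurable_funM => //.
  rewrite (_ : (fun p : Omega * borel G => _) =
    (fun p : Omega * borel G => X (theta (- p.2)%R p.1) C)); last first.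
    by apply/funext => p; exact: window_massE.
  apply: (measurableT_comp (measurable_kernel X _ mC)).
  by apply: measurable_theta => //; exact: measurable_funN_borel.
transitivity (\int[Q]_w (lam C * \int[mcond lam mC P0]_r h w r)).
  apply: eq_integral => w _.
  transitivity (\int[X w]_s \int[lam]_r
      (k w r * (\1_C (s + r)%R)%:E * (\1_C r)%:E)).
    by apply: eq_integral => s _; apply: eq_integral => r _; rewrite muleAC.
  rewrite (swap w (fun s r => k w r * (\1_C (s + r)%R)%:E)); last 2 first.
  - by move=> s r; rewrite mule_ge0// lee_fin.
  - apply: emeasurable_funM; first exact: (measurableT_comp (mk1 w)).
    by apply: mI; exact: measurable_funD_borel.
  congr (_ * _); apply: eq_integral => r _.
  rewrite ge0_integralZl//; last by apply: mI; exact: measurable_funD_borel.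
  rewrite /h muleC; congr (_ * _).
  transitivity (\int[X w]_s (\1_[set (c - r)%R | c in C] s)%:E).
    by apply: eq_integral => s _; rewrite mem_translate opprK.
  by rewrite integral_indicT//; exact: measurable_translate.
transitivity (\int[Q]_w (lam C * \int[mcond lam mC P0]_r
    \int[N mC (w, (- r)%R)]_s h (theta s w) (s + r)%R)); last first.
  apply: eq_integral => w _.
  transitivity (\int[X w]_s \int[lam]_r
      (k (theta s w) (s + r)%R * (\1_C (s + r)%R)%:E * (\1_C r)%:E)); last first.
    apply: eq_integral => s _.
    rewrite -(haar_shift G2 lam_inv s
      (f := fun r => k (theta s w) r * (\1_C r)%:E * (\1_C (r - s)%R)%:E)).
    - by apply: eq_integral => r _; rewrite addrK (addrC r).
    - apply: emeasurable_funM; last by apply: mI; exact: measurable_funB_borel.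
      by apply: emeasurable_funM => //; exact: mI.
    - by move=> r; rewrite !mule_ge0// lee_fin.
  have mks : measurable_fun setT (fun p : borel G * borel G =>
      k (theta p.1 w) (p.1 + p.2)%R * (\1_C (p.1 + p.2)%R)%:E).
    apply: emeasurable_funM; last by apply: mI; exact: measurable_funD_borel.
    apply: (measurable_fun_comp2 mk); first exact: measurable_theta.
    exact: measurable_funD_borel.
  rewrite (swap w
    (fun s r => k (theta s w) (s + r)%R * (\1_C (s + r)%R)%:E))//; last first.
    by move=> s r; rewrite mule_ge0// lee_fin.
  congr (_ * _); apply: eq_integral => r _.
  have mkr : measurable_fun setT (fun s : borel G => k (theta s w) (s + r)%R).
    apply: (measurable_fun_comp2 mk); first exact: measurable_theta.
    exact: measurable_funD_borel.
  transitivity (window_mass X C w (- r)%R *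
      \int[N mC (w, (- r)%R)]_s k (theta s w) (s + r)%R).
    rewrite -ge0_integralZl ?measure_ge0//; apply: eq_integral => s _.
    rewrite /h opprD (addrC (- s)%R) (window_mass_theta theta_flow X_inv mC)//.
  rewrite (integral_TCker G2 X_lf X_inv mC pC P0 w (- r)%R)//.
  by apply: eq_integral => s _; rewrite opprK.
have mh' : measurable_fun setT (fun w => \int[mcond lam mC P0]_r h w r).
  exact: (measurable_integral_sfinite (mcond lam mC P0)).
have mNh : measurable_fun setT (fun w => \int[mcond lam mC P0]_r
    \int[N mC (w, (- r)%R)]_s h (theta s w) (s + r)%R).
  apply: (measurable_integral_sfinite (mcond lam mC P0) (g := fun w r =>
    \int[N mC (w, (- r)%R)]_s h (theta s w) (s + r)%R)).
    by move=> w r; exact: integral_ge0.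
  apply: (measurable_integral_kernel (N mC)
    (f := fun p : Omega * borel G => (p.1, - p.2)%R)
    (g := fun (p : Omega * borel G) s => h (theta s p.1) (s + p.2)%R)) => //.
    by apply: measurable_fun_pair => //; exact: measurable_funN_borel.
  apply: (measurable_fun_comp2 mh).
    by apply: measurable_theta => //; exact: measurableT_comp.
  by apply: measurable_funD_borel => //; exact: measurableT_comp.
rewrite (ge0_integralZl Q measurableT mh' _ (measure_ge0 lam C)); last first.
  by move=> w _; apply: integral_ge0 => r _.
rewrite (ge0_integralZl Q measurableT mNh _ (measure_ge0 lam C)); last first.
  by move=> w _; apply: integral_ge0 => r _; exact: integral_ge0.
by congr (_ * _); exact/esym/mass_stationary_integral.
Qed.

End mass_stationary_window.

Section polarization.
Context d (T : measurableType d) (G : topologicalZmodType) (R : realType).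
Hypotheses (G_hausdorff : hausdorff_space G)
  (G_locally_compact : locally_compact [set: G])
  (G2 : @second_countable G).
Context (lam : {measure set (borel G) -> \bar R}).
Hypothesis lam_lf : locally_finite lam.
Context (pos : T -> borel G) (mpos : measurable_fun setT pos).
Context (m1 m2 : {measure set (T * borel G) -> \bar R}).
Local Open Scope ereal_scope.
Hypothesis m12 : forall (C : set (borel G)) (S : set T), continuity_set lam C ->
  measurable S -> (forall p, S p -> C (pos p)) -> m1 (S `*` C) = m2 (S `*` C).

Let rectangle_splitr (m : {measure set (T * borel G) -> \bar R}) S D1 D2 :
  measurable S -> measurable D1 -> measurable D2 -> D1 `&` D2 = set0 ->
  m (S `*` (D1 `|` D2)) = m (S `*` D1) + m (S `*` D2).
Proof.
move=> mS mD1 mD2 D12; rewrite -measureU; try exact: measurableX.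
  by congr (m _); apply/seteqP; split => [[x y] [/= Sx [?|?]]|[x y] [[/= ? ?]|[/= ? ?]]];
    [left|right|split => //; left|split => //; right].
apply/seteqP; split => // -[x y] [[/= _ y1] [/= _ y2]].
by have : (D1 `&` D2) y by []; rewrite D12.
Qed.

Let rectangle_splitl (m : {measure set (T * borel G) -> \bar R}) S1 S2 D :
  measurable S1 -> measurable S2 -> measurable D -> S1 `&` S2 = set0 ->
  m ((S1 `|` S2) `*` D) = m (S1 `*` D) + m (S2 `*` D).
Proof.
move=> mS1 mS2 mD S12; rewrite -measureU; try exact: measurableX.
  by congr (m _); apply/seteqP; split => [[x y] [/= [?|?] ?]|[x y] [[/= ? ?]|[/= ? ?]]];
    [left|right|split => //; left|split => //; right].
apply/seteqP; split => // -[x y] [[/= x1 _] [/= x2 _]].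
by have : (S1 `&` S2) x by []; rewrite S12.
Qed.

(** The window [K] yields rectangles with the same window on both sides;
    polarization, by means of the windows [D] and [K `\` D], reaches the
    rectangles with distinct sides. *)
Lemma measure_polarize (K D : set (borel G)) (S : set T) :
  continuity_set lam K -> continuity_set lam D -> D `<=` K ->
  measurable S -> (forall p, S p -> K (pos p)) -> m1 (S `*` K) < +oo ->
  m1 (S `*` D) = m2 (S `*` D).
Proof.
move=> cK cD DK mS SK fin.
have [mK _ _] := cK; have [mD _ _] := cD.
have cKD := continuity_setD cK cD; have [mKD _ _] := cKD.
pose S1 := S `&` (pos @^-1` D); pose S2 := S `&` (pos @^-1` ~` D).
have mpre (B : set (borel G)) : measurable B -> measurable (pos @^-1` B).
  by move=> mB; rewrite -[X in measurable X]setTI; exact: mpos.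
have mS1 : measurable S1 by apply: measurableI => //; exact: mpre.
have mS2 : measurable S2.
  by apply: measurableI => //; apply: mpre; exact: measurableC.
have SE : S = S1 `|` S2.
  by rewrite /S1 /S2 -setIUr -preimage_setU setUv preimage_setT setIT.
have S12 : S1 `&` S2 = set0.
  by apply/seteqP; split => // p [[_ Dp] [_ nDp]].
have KE : K = D `|` (K `\` D) by rewrite setDUK.
have DKD : D `&` (K `\` D) = set0 by rewrite setDE setICA setICr setI0.
have split1 (m : {measure set (T * borel G) -> \bar R}) :
    m (S `*` D) = m (S1 `*` D) + m (S2 `*` D).
  by rewrite [in LHS]SE; exact: rectangle_splitl.
have split2 (m : {measure set (T * borel G) -> \bar R}) :
    m (S2 `*` K) = m (S2 `*` D) + m (S2 `*` (K `\` D)).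
  by rewrite [in LHS]KE; exact: rectangle_splitr.
have e1 : m1 (S1 `*` D) = m2 (S1 `*` D).
  by apply: (m12 cD mS1) => p [].
have e2 : m1 (S2 `*` K) = m2 (S2 `*` K).
  by apply: (m12 cK mS2) => p [Sp _]; exact: SK.
have e3 : m1 (S2 `*` (K `\` D)) = m2 (S2 `*` (K `\` D)).
  apply: (m12 cKD mS2) => p [Sp nDp].
  by split; [exact: SK|exact: nDp].
have fin3 : m2 (S2 `*` (K `\` D)) \is a fin_num.
  rewrite -e3 ge0_fin_numE ?measure_ge0//; apply: le_lt_trans fin.
  apply: le_measure; rewrite ?inE; try exact: measurableX.
  by move=> [p y] [/= [Sp _] [Ky _]].
rewrite (split1 m1) (split1 m2) e1; congr (_ + _).
move: e2; rewrite (split2 m1) (split2 m2) e3.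
move=> /(congr1 (fun z => z - m2 (S2 `*` (K `\` D)))).
by rewrite (addeK _ fin3) (addeK _ fin3).
Qed.

Lemma measure_eq_window (K D : set (borel G)) (S : set T) :
  continuity_set lam K -> measurable D -> D `<=` K ->
  measurable S -> (forall p, S p -> K (pos p)) -> m1 (S `*` K) < +oo ->
  m1 (S `*` D) = m2 (S `*` D).
Proof.
move=> cK mD DK mS SK fin; have [mK _ _] := cK.
have [K' [cK' _ UK']] := continuity_exhaustion G_hausdorff G_locally_compact G2
  lam_lf.
apply: (@measure_eq_setX _ _ _ _ _ m1 m2
  (continuity_set lam) K' S K) => //.
- exact: continuity_generate.
- by move=> A B; exact: continuity_setI.
- move=> E cE; apply: (measure_polarize cK) => //; exact: continuity_setI.
Qed.

End polarization.

Section recover_mecke.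
Context d (Omega : measurableType d) (G : topologicalZmodType) (R : realType).
Hypotheses (G_hausdorff : hausdorff_space G)
  (G_locally_compact : locally_compact [set: G])
  (G2 : @second_countable G).
Context (theta : borel G -> Omega -> Omega) (theta_flow : measurable_flow theta).
Context (X : R.-sfker Omega ~> borel G).
Hypothesis X_lf : forall w, locally_finite (X w).
Context (lam : {sigma_finite_measure set (borel G) -> \bar R}).
Hypothesis lam_lf : locally_finite lam.
Hypothesis lamT : lam setT != 0%E.
Context (Q : {sigma_finite_measure set Omega -> \bar R}).
Local Open Scope ereal_scope.

Hypothesis window_balance : forall (C : set (borel G)) (k : Omega -> borel G -> \bar R),
  continuity_set lam C ->
  (forall w r, 0 <= k w r) ->
  measurable_fun setT (fun p : Omega * borel G => k p.1 p.2) ->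
  \int[Q]_w \int[X w]_s \int[lam]_r
    (k w r * (\1_C r)%:E * (\1_C (s + r)%R)%:E) =
  \int[Q]_w \int[X w]_s \int[lam]_r
    (k (theta s w) r * (\1_C r)%:E * (\1_C (r - s)%R)%:E).

Let Z := (unit * Omega * borel G * borel G)%type.

Let mw : measurable_fun setT (fun z : Z => z.1.1.2).
Proof. by apply: measurableT_comp => //; exact: measurableT_comp. Qed.

Let ms : measurable_fun setT (fun z : Z => z.1.2).
Proof. exact: measurableT_comp. Qed.

Let mF1 : measurable_fun setT
  (fun z : Z => ((z.1.1.2, z.2), z.1.2 + z.2)%R).
Proof.
apply: measurable_fun_pair; first exact: measurable_fun_pair.
exact: measurable_funD_borel.
Qed.

Let mF2 : measurable_fun setT
  (fun z : Z => ((theta z.1.2 z.1.1.2, z.2), z.2 - z.1.2)%R).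
Proof.
apply: measurable_fun_pair.
  by apply: measurable_fun_pair => //; exact: measurable_theta.
exact: measurable_funB_borel.
Qed.

(** The laws of [(w, r, s + r)] and of [(theta_s w, r, r - s)] under
    [Q (dw) X (w, ds) lam (dr)]; they determine the two sides of the Mecke
    equation, because the displacement [s], respectively [- s], is the
    difference of the last two coordinates. *)
Definition law_before : {measure set (Omega * borel G * borel G) -> \bar R} :=
  transport_law X lam Q (F := fun w s r => ((w, r), s + r)%R) mF1.

Definition law_after : {measure set (Omega * borel G * borel G) -> \bar R} :=
  transport_law X lam Q (F := fun w s r => ((theta s w, r), r - s)%R) mF2.

Let OG := (Omega * borel G)%type.

Lemma law_window (C : set (borel G)) (S : set OG) : continuity_set lam C ->
  measurable S -> (forall p, S p -> C p.2) ->
  law_before (S `*` C) = law_after (S `*` C).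
Proof.
move=> cC mS SC; have [mC _ _] := cC.
have mSC : measurable (S `*` C) by exact: measurableX.
have SCE w r : (\1_S (w, r))%:E * (\1_C r)%:E = (\1_S (w, r))%:E :> \bar R.
  rewrite !indicE; case: (boolP (_ \in S)) => [/set_mem/SC Cr|_].
    by rewrite mem_set// mule1.
  by rewrite mul0e.
rewrite [LHS](transport_lawE X lam Q mF1 mSC).
rewrite [RHS](transport_lawE X lam Q mF2 mSC).
transitivity (\int[Q]_w \int[X w]_s \int[lam]_r
    ((\1_S (w, r))%:E * (\1_C r)%:E * (\1_C (s + r)%R)%:E)).
  apply: eq_integral => w _; apply: eq_integral => s _.
  by apply: eq_integral => r _; rewrite SCE indicX EFinM.
have k0 w r : 0 <= (\1_S (w, r))%:E :> \bar R by rewrite lee_fin.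
have mk : measurable_fun setT (fun p : OG => (\1_S (p.1, p.2))%:E : \bar R).
  by apply: measurable_indic_comp => //; exact: measurable_fun_pair.
transitivity (\int[Q]_w \int[X w]_s \int[lam]_r
    ((\1_S (theta s w, r))%:E * (\1_C r)%:E * (\1_C (r - s)%R)%:E)).
  exact: (window_balance (k := fun w r => (\1_S (w, r))%:E) cC k0 mk).
apply: eq_integral => w _; apply: eq_integral => s _.
by apply: eq_integral => r _; rewrite SCE indicX EFinM.
Qed.

(** If [r] and [s + r] lie in [K], then [s] lies in the set [L] of differences,
    so that a bound of the mass of [L] bounds the whole integral. *)
Let law_before_lty (K L : set (borel G)) (A : set Omega) (j : nat) :
  measurable K -> lam K < +oo -> measurable A -> Q A < +oo -> measurable L ->
  (forall r s, K r -> K (s + r)%R -> L s) ->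
  (forall w, A w -> X w L <= j%:R%:E) ->
  law_before ((A `*` K) `*` K) < +oo.
Proof.
move=> mK Koo mA Aoo mL KL AL.
have mAKK : measurable ((A `*` K) `*` K : set (OG * borel G)).
  by apply: measurableX => //; exact: measurableX.
have m1 (E : set (borel G)) : measurable E ->
    measurable_fun setT (fun x => (\1_E x)%:E : \bar R).
  by move=> mE; exact/measurable_EFinP/measurable_indic.
rewrite [ltLHS](transport_lawE X lam Q mF1 mAKK).
apply: (@le_lt_trans _ _ (\int[Q]_w ((\1_A w)%:E * (j%:R%:E * lam K)))); last first.
  have jK : 0 <= j%:R%:E * lam K by rewrite mule_ge0// lee_fin.
  rewrite ge0_integralZr//; last exact/measurable_EFinP/measurable_indic.
  rewrite integral_indicT// -ge0_fin_numE ?mule_ge0// fin_numM//.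
    by rewrite ge0_fin_numE.
  by rewrite fin_numM// ge0_fin_numE.
have mind : measurable_fun setT
    (fun z : Omega * borel G * borel G =>
      (\1_((A `*` K) `*` K) ((z.1.1, z.2), z.1.2 + z.2)%R)%:E : \bar R).
  apply: measurable_indic_comp => //; apply: measurable_fun_pair.
    apply: measurable_fun_pair => //; exact: measurableT_comp.
  by apply: measurable_funD_borel => //; exact: measurableT_comp.
apply: ge0_le_integral => //.
- by move=> w _; apply: integral_ge0 => s _; apply: integral_ge0.
- apply: (measurable_integral_kernel X (f := id) (g := fun w s =>
    \int[lam]_r (\1_((A `*` K) `*` K) ((w, r), s + r)%R)%:E)) => //.
    by move=> w s; exact: integral_ge0.
  exact: (measurable_integral_sfinite lam (g := fun (p : Omega * borel G) r =>
    (\1_((A `*` K) `*` K) ((p.1, r), p.2 + r)%R)%:E)).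
- apply: emeasurable_funM; last exact: measurable_cst.
  exact/measurable_EFinP/measurable_indic.
move=> w _; have [Aw|nAw] := pselect (A w); last first.
  rewrite integral0_eq; first by rewrite mule_ge0// mule_ge0// lee_fin.
  move=> s _; apply: integral0_eq => r _; rewrite !indicX.
  by rewrite [\1_A w]indicE memNset// !mul0r.
rewrite [\1_A w]indicE mem_set// mul1e.
apply: (@le_trans _ _ (\int[X w]_s ((\1_L s)%:E * lam K))); last first.
  rewrite ge0_integralZr//; last exact: m1.
  by rewrite integral_indicT//; apply: lee_wpmul2r => //; exact: AL.
apply: ge0_le_integral => //.
- by move=> s _; exact: integral_ge0.
- apply: (measurable_integral_sfinite lam (g := fun s r : borel G =>
    (\1_((A `*` K) `*` K) ((w, r), s + r)%R)%:E)) => //.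
  apply: measurable_indic_comp => //; apply: measurable_fun_pair.
    by apply: measurable_fun_pair.
  exact: measurable_funD_borel.
- by apply: emeasurable_funM => //; exact: m1.
move=> s _; rewrite -integral_indicT// -ge0_integralZl//; last exact: m1.
apply: ge0_le_integral => //.
- apply: measurable_indic_comp => //; apply: measurable_fun_pair.
    by apply: measurable_fun_pair.
  exact: measurable_funD_borel.
- by apply: emeasurable_funM => //; exact: m1.
move=> r _; rewrite !indicX -EFinM lee_fin !indicE.
have [/set_mem Kr|_] := boolP (r \in K); last by rewrite mulr0 mul0r mulr0.
have [/set_mem Ksr|_] := boolP ((s + r)%R \in K).
  by rewrite (mem_set Aw) (mem_set (KL _ _ Kr Ksr)) !mulr1.
by rewrite mulr0 mulr_ge0.
Qed.

(** The comparison of the two laws on pairs of windows needs a cover by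
    rectangles on which [law_before] is finite; they are obtained by bounding
    the mass [X w] of the differences of the members of a window. *)
Lemma law_eq (S : set (OG * borel G)) : measurable S ->
  law_before S = law_after S.
Proof.
move: S; have [K [cK ndK UK]] := continuity_exhaustion G_hausdorff
  G_locally_compact G2 lam_lf.
have mK n : measurable (K n) by have [] := cK n.
have pK n : precompact (K n) by have [] := cK n.
have [E cE EQ] := sigma_finiteT Q.
have mE n : measurable (E n) by have [] := EQ n.
have Eoo n : Q (E n) < +oo by have [] := EQ n.
pose L n : set (borel G) :=
  (fun p : borel G * borel G => p.1 - p.2)%R @` (closure (K n) `*` closure (K n)).
have cL n : compact (L n).
  apply: continuous_compact.
    by apply: continuous_subspaceT => x; exact: (@sub_continuous G).
  have := pK n; rewrite precompactE => cKn.
  exact: compact_setX.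
have mL n : measurable (L n) by apply: borel_closed; exact: compact_closed.
have KL n r s : K n r -> K n (s + r)%R -> L n s.
  move=> Kr Ksr; exists ((s + r)%R, r) => /=; last by rewrite addrK.
  by split; exact: subset_closure.
(* [p] lists a piece of finite [Q]-measure, a bound and a window. *)
pose A (p : nat * nat * nat) : set Omega :=
  E p.1.1 `&` [set w | X w (L p.2) <= p.1.2%:R%:E].
have mA p : measurable (A p).
  apply: measurableI => //; rewrite -[X in measurable X]setTI.
  by apply: emeasurable_fun_infty_c => //; exact/measurable_kernel.
have Aoo p : Q (A p) < +oo.
  by apply: le_lt_trans (Eoo p.1.1); apply: le_measure; rewrite ?inE// => w [].
pose En n : set OG :=
  if @unpickle (nat * nat * nat)%type n is Some p then A p `*` K p.2 else set0.
pose Fn n : set (borel G) :=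
  if @unpickle (nat * nat * nat)%type n is Some p then K p.2 else set0.
apply: (measure_eq_prod (E := En) (F := Fn)).
- by move=> n; rewrite /En; case: unpickle => // p; exact: measurableX.
- by move=> n; rewrite /Fn; case: unpickle.
- rewrite -subTset => -[[w r] u] _.
  have [i _ Eiw] : (\bigcup_n E n) w by rewrite -cE.
  have [k1 _ Kr] : (\bigcup_n K n) r by rewrite UK.
  have [k2 _ Ku] : (\bigcup_n K n) u by rewrite UK.
  pose k := maxn k1 k2.
  have [j Xj] : exists j : nat, X w (L k) <= j%:R%:E.
    have Xoo : X w (L k) < +oo by exact: X_lf.
    have Xfin : X w (L k) \is a fin_num by rewrite ge0_fin_numE.
    exists (Num.truncn (fine (X w (L k)))).+1.
    by rewrite -(fineK Xfin) lee_fin ltW// truncnS_gt.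
  exists (pickle ((i, j), k)) => //; rewrite /En /Fn pickleK; split; last first.
    exact: (ndK _ _ (leq_maxr k1 k2)).
  by split => //; exact: (ndK _ _ (leq_maxl k1 k2)).
- move=> n; rewrite /En /Fn; case: unpickle => [p|]; last first.
    by rewrite setX0 measure0.
  apply: (law_before_lty (L := L p.2) (j := p.1.2)) => //.
  + exact: precompact_lty.
  + exact: KL.
  + by move=> w [].
- move=> n S D mS mD; rewrite /En /Fn; case: unpickle => [p|]; last first.
    by move=> _; rewrite subset0 => ->; rewrite setX0 !measure0.
  move=> SA DK.
  have mpos : measurable_fun setT (fun p : OG => p.2) by exact: measurable_snd.
  apply: (measure_eq_window G_hausdorff G_locally_compact G2 lam_lf mpos
    law_window (cK p.2)) => //.
    by move=> q /SA[].
  apply: (le_lt_trans _ (law_before_lty (mK p.2) _ (mA p) (Aoo p) (mL p.2)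
    (@KL p.2) _ (j := p.1.2))).
  + apply: le_measure; rewrite ?inE; [exact: measurableX| |].
      by apply: measurableX => //; exact: measurableX.
    by move=> [q u] [/SA Sq Ku]; split.
  + exact: precompact_lty.
  + by move=> w [].
Qed.

(** Integrate [\1_K r * g w (u - r)] against the two laws, with [u] the last
    coordinate: the integral over [r] separates and contributes the factor
    [lam K], which can be cancelled. *)
Lemma window_balance_mecke : mecke_equation theta X Q.
Proof.
move=> g mg g0.
have [K [cK ndK UK]] := continuity_exhaustion G_hausdorff
  G_locally_compact G2 lam_lf.
have mK n : measurable (K n) by have [] := cK n.
have [k Kk] : exists k, lam (K k) != 0.
  apply: contrapT => /forallNP h; move/eqP: lamT; apply; apply/eqP.
  rewrite -measure_le0 -UK; apply: (@le_trans _ _ (\sum_(n <oo) lam (K n))).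
    by apply: measure_sigma_subadditive => //; rewrite UK.
  by rewrite eseries0// => n _ _; apply: contrapT => /eqP /(h n).
have Koo : lam (K k) < +oo by have [? ? _] := cK k; exact: precompact_lty.
have Kfin : lam (K k) \is a fin_num by rewrite ge0_fin_numE.
pose h (z : OG * borel G) := (\1_(K k) z.1.2)%:E * g z.1.1 (z.2 - z.1.2)%R.
have h0 z : 0 <= h z by rewrite mule_ge0// lee_fin.
have mh : measurable_fun setT h.
  apply: emeasurable_funM.
    by apply: measurable_indic_comp => //; exact: measurableT_comp.
  apply: (measurable_fun_comp2 mg); first exact: measurableT_comp.
  by apply: measurable_funB_borel => //; exact: measurableT_comp.
have KE (c : \bar R) : 0 <= c -> \int[lam]_r ((\1_(K k) r)%:E * c) = c * lam (K k).
  move=> c0; rewrite ge0_integralZr//; first by rewrite integral_indicT// muleC.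
  exact/measurable_EFinP/measurable_indic.
have before : \int[law_before]_z h z =
    \int[Q]_w \int[X w]_s (g w s * lam (K k)).
  rewrite [LHS](integral_transport_law X lam Q mF1 h0 mh).
  apply: eq_integral => w _; apply: eq_integral => s _; rewrite -KE//.
  by apply: eq_integral => r _; rewrite /h /= addrK.
have after : \int[law_after]_z h z =
    \int[Q]_w \int[X w]_s (g (theta s w) (- s)%R * lam (K k)).
  rewrite [LHS](integral_transport_law X lam Q mF2 h0 mh).
  apply: eq_integral => w _; apply: eq_integral => s _; rewrite -KE//.
  by apply: eq_integral => r _; rewrite /h /= addrAC subrr add0r.
have mg' : measurable_fun setT (fun p : OG => g (theta p.2 p.1) (- p.2)%R).
  apply: (measurable_fun_comp2 mg); first exact: measurable_theta.
  exact: measurable_funN_borel.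
have pull (f : Omega -> borel G -> \bar R) : (forall w s, 0 <= f w s) ->
    measurable_fun setT (fun p : OG => f p.1 p.2) ->
    \int[Q]_w \int[X w]_s (f w s * lam (K k)) =
    lam (K k) * \int[Q]_w \int[X w]_s f w s.
  move=> f0 mf; have mf1 w : measurable_fun setT (f w).
    exact: (measurable_fun_comp2 mf).
  rewrite muleC -ge0_integralZr//.
  - apply: eq_integral => w _; rewrite ge0_integralZr//.
  - exact: (measurable_integral_kernel X (f := id)).
  - by move=> w _; exact: integral_ge0.
apply: (fin_muleI Kfin Kk).
transitivity (\int[law_after]_z h z).
  rewrite after; apply/esym.
  exact: (pull (fun w s => g (theta s w) (- s)%R) (fun _ _ => g0 _ _) mg').
transitivity (\int[law_before]_z h z).
  by apply/esym/eq_measure_integral => S mS _; exact: law_eq.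
by rewrite before; exact: (pull g g0 mg).
Qed.

End recover_mecke.

(** * The equivalence *)

Lemma measurable_lfmeasure_eval (R : realType) (G : topologicalZmodType)
    (B : set (borel G)) : measurable B ->
  measurable_fun setT (fun mu : lfmeasure G R => mu B).
Proof.
move=> mB _ Y mY; apply: sub_sigma_algebra.
by exists B => //; exists Y.
Qed.

(** A random measure as an s-finite kernel, the form in which integrals with
    respect to it depend measurably on parameters and can be interchanged. *)
Lemma random_measure_kernel (R : realType) d (Omega : measurableType d)
    (G : topologicalZmodType) (xi : Omega -> lfmeasure G R) :
  hausdorff_space G -> locally_compact [set: G] -> @second_countable G ->
  measurable_fun setT xi ->
  exists X : R.-sfker Omega ~> borel G,
    forall w, X w = xi w :> {measure set (borel G) -> \bar R}.
Proof.
move=> hG lG G2 mxi.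
pose k : Omega -> {measure set (borel G) -> \bar R} := fun w => xi w.
have mk U : measurable U -> measurable_fun setT (k ^~ U).
  by move=> mU; exact: (measurableT_comp (measurable_lfmeasure_eval mU) mxi).
pose kk : R.-ker Omega ~> borel G := HB.pack k (isKernel.Build _ _ _ _ _ k mk).
have [K [mK pK _ UK]] := precompact_exhaustion R hG lG G2.
apply: (sfinite_of_exhaustion (k := kk) mK UK) => n w.
by apply: precompact_lty => //; exact: lfmeasureP.
Qed.

Lemma haar_sigma_finite (R : realType) (G : topologicalZmodType)
    (lam : {measure set (borel G) -> \bar R}) :
  hausdorff_space G -> locally_compact [set: G] -> @second_countable G ->
  locally_finite lam ->
  exists lam' : {sigma_finite_measure set (borel G) -> \bar R},
    lam = lam' :> {measure set (borel G) -> \bar R}.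
Proof.
move=> hG lG G2 lam_lf.
have [K [mK pK _ UK]] := precompact_exhaustion R hG lG G2.
have sf : sigma_finite setT lam.
  exists K => // n; split => //; exact: precompact_lty.
pose lam' : {sigma_finite_measure set (borel G) -> \bar R} :=
  HB.pack_for (SigmaFiniteMeasure.type (borel G) R) (Measure.sort lam)
    (isSFinite.Build _ _ _ _ (sfinite_measure_sigma_finite sf))
    (isSigmaFinite.Build _ _ _ _ sf).
by exists lam'; exact: eq_measure.
Qed.

Lemma TCker_TC d (Omega : measurableType d) (G : topologicalZmodType)
    (R : realType) (G2 : @second_countable G) (X : R.-sfker Omega ~> borel G)
    (xi : Omega -> lfmeasure G R) (C : set (borel G)) (mC : measurable C)
    (P0 : probability (borel G) R) (w : Omega) (u : borel G) :
  X w = xi w :> {measure set (borel G) -> \bar R} ->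
  (TCker G2 X mC P0 (w, u) : set (borel G) -> \bar R) = TC (xi w) mC P0 u.
Proof. by move=> XE; rewrite /TC /mcond -XE. Qed.

Theorem theorem7p2 (R : realType) (d : measure_display)
    (Omega : measurableType d) (G : topologicalZmodType)
    (G_hausdorff : hausdorff_space G)
    (G_locally_compact : locally_compact [set: G])
    (G_second_countable : @second_countable G)
    (lam : {measure set (borel G) -> \bar R}) (lam_haar : haar_measure lam)
    (P0 : probability (borel G) R)
    (theta : borel G -> Omega -> Omega) (theta_flow : measurable_flow theta)
    (xi : Omega -> lfmeasure G R) (xi_inv : invariant_random_measure theta xi)
    (Q : {sigma_finite_measure set Omega -> \bar R})
    (Q_xi : Q [set w | xi w [set: borel G] = 0%E] = 0%E) :
  mass_stationary theta lam P0 xi Q <->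
  (forall T : R.-ker (Omega * borel G)%type ~> borel G,
     weighted_transport_kernel T -> bounded_kernel T ->
     preserving_kernel xi T -> invariant_kernel theta T ->
     invariant_under theta Q T).
Proof.
have [lam_lf lam_inv lamT] := lam_haar.
have [lam' lamE] := haar_sigma_finite G_hausdorff G_locally_compact
  G_second_countable lam_lf.
subst lam.
have [mxi xi_shift] := xi_inv.
have [X XE] := random_measure_kernel G_hausdorff G_locally_compact
  G_second_countable mxi.
have X_lf w : locally_finite (X w) by rewrite XE; exact: lfmeasureP.
have X_inv (w : Omega) (s : borel G) (B : set (borel G)) : measurable B ->
    X (theta s w) [set b - s | b in B] = X w B.
  by move=> mB; rewrite !XE; exact: xi_shift.
have preservingE (T : R.-ker (Omega * borel G)%type ~> borel G) :
    preserving_kernel xi T <-> forall (w : Omega) (B : set (borel G)),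
      measurable B -> (\int[X w]_s T (w, s) B = X w B)%E.
  by split => h w B mB; have := h w B mB; rewrite XE.
have lawE (C : set (borel G)) (mC : measurable C) (A : set (Omega * borel G)) :
    measurable A ->
    mass_law G_second_countable theta_flow X mC P0 lam' Q A =
    (\int[Q]_w \int[mcond lam' mC P0]_r \int[TC (xi w) mC P0 (- r)%R]_s
        (\1_A (theta s w, s + r)%R)%:E)%E.
  move=> mA; rewrite [LHS](mass_lawE G_second_countable theta_flow X mC P0 lam' Q mA).
  apply: eq_integral => w _; apply: eq_integral => r _.
  apply: eq_measure_integral => B _ _.
  by rewrite [LHS](congr1 (fun m => m B) (TCker_TC G_second_countable mC P0 (- r)%R (XE w))).
have QX : Q [set w | X w setT = 0%E] = 0%E.
  rewrite -[RHS]Q_xi; congr (Q _).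
  by apply/seteqP; split => w /=; rewrite XE.
split=> [[_ stat] T _ Tb /preservingE Tp Ti|inv].
  apply: (mecke_invariant_under G_hausdorff G_locally_compact
    G_second_countable theta_flow X_lf X_inv QX _ Tb Ti Tp).
  have lamT' : lam' setT != 0%E by exact/eqP.
  apply: (window_balance_mecke G_hausdorff G_locally_compact
    G_second_countable theta_flow X_lf lam_lf lamT') => C k cC k0 mk.
  apply: (mass_stationary_window (P0 := P0) X_lf X_inv lam_inv lam_lf _ cC k0 mk).
  move=> D mD pD D0 bD A mA.
  by rewrite [LHS](lawE D mD A mA); exact: (stat D mD pD D0 bD A mA).
split; first exact: Q_xi.
move=> C mC pC C0 bC A mA; rewrite -[LHS](lawE C mC A mA).
have lamC0 : lam' C != 0%E by rewrite gt_eqF.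
apply: (invariance_mass_law G_hausdorff G_second_countable theta_flow X_lf
  X_inv mC pC P0 lam_inv lamC0 (precompact_lty lam_lf mC pC) _ mA).
by move=> T Tw Tb Tp Ti; exact: (inv T Tw Tb ((preservingE T).2 Tp) Ti).
Qed.
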